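(* Let $Q\subseteq\mathbb Z$ be a subset which generates $\mathbb Z$. Then $Q$ is a Kazhdan set in $\mathbb Z$ if and only if there exists $\delta\in(0,1)$ such that $Q$ does not belong to the class $\delta$-$\mathbf{Ka}^+$, i.e. such that there is no continuous Borel probability measure $\sigma$ on $\mathbb T$ with $\inf_{n\in Q}|\widehat\sigma(n)|>\delta$.
   Context: For a Borel probability measure $\sigma$ on the unit circle $\mathbb T$, $\widehat\sigma(n)=\int_{\mathbb T}\lambda^n\,d\sigma(\lambda)$, $n\in\mathbb Z$; $\sigma$ is continuous if it has no atoms. For $\delta\in(0,1)$, $Q\subseteq\mathbb Z$ belongs to $\delta$-$\mathbf{Ka}^+$ if there exists a continuous probability measure $\sigma$ on $\mathbb T$ with $\inf_{n\in Q}|\widehat\sigma(n)|>\delta$. A subset $Q$ is a Kazhdan set in $\mathbb Z$ if there exists $\varepsilon>0$ such that every unitary representation $\pi$ of $\mathbb Z$ having a vector $x$ with $\sup_{n\in Q}\|\pi(n)x-x\|<\varepsilon\|x\|$ has a non-zero $\mathbb Z$-invariant vector. *)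

(* Defs.v *)
From HB Require Import structures.
From mathcomp Require Import all_boot all_order all_algebra.
From mathcomp Require Import all_classical all_reals.
From mathcomp Require Import topology normedtype sequences trigo measure
  lebesgue_measure lebesgue_integral probability.
From mathcomp Require Import complex.

Set Implicit Arguments.
Unset Strict Implicit.
Unset Printing Implicit Defensive.

Import Order.TTheory GRing.Theory Num.Theory.
Local Open Scope ring_scope.
Local Open Scope classical_set_scope.

Inductive gen_subgroup (Q : set int) : int -> Prop :=
  | gen_base q : Q q -> gen_subgroup Q q
  | gen_zero : gen_subgroup Q 0
  | gen_add a b : gen_subgroup Q a -> gen_subgroup Q b -> gen_subgroup Q (a + b)
  | gen_opp a : gen_subgroup Q a -> gen_subgroup Q (- a).

Definition generates_Z (Q : set int) : Prop := forall m : int, gen_subgroup Q m.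

Section Hilbert.
Variable R : realType.
Variable V : lmodType R[i].
Variable ip : V -> V -> R[i].

Definition hnorm (x : V) : R := Num.sqrt (complex.Re (ip x x)).

Definition is_inner_product : Prop :=
  [/\ (forall (a : R[i]) (x y z : V), ip (a *: x + y) z = a * ip x z + ip y z),
      (forall x y : V, ip y x = conjc (ip x y)),
      (forall x : V, complex.Im (ip x x) = 0 /\ 0 <= complex.Re (ip x x)) &
      (forall x : V, ip x x = 0 -> x = 0)].

Definition is_complete : Prop :=
  forall u : nat -> V,
    (forall e : R, 0 < e -> exists N : nat, forall m n : nat,
        (N <= m)%N -> (N <= n)%N -> hnorm (u m - u n) < e) ->
    exists l : V, forall e : R, 0 < e -> exists N : nat, forall n : nat,
        (N <= n)%N -> hnorm (u n - l) < e.

Definition is_Hilbert : Prop := is_inner_product /\ is_complete.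

Definition unitary_rep (pi : int -> V -> V) : Prop :=
  [/\ (forall x, pi 0 x = x),
      (forall (m n : int) x, pi (m + n) x = pi m (pi n x)),
      (forall n (a : R[i]) (x y : V), pi n (a *: x + y) = a *: pi n x + pi n y) &
      (forall n (x y : V), ip (pi n x) (pi n y) = ip x y)].

End Hilbert.

(* Q is a Kazhdan set in Z. "sup_{n in Q} ||pi(n)x - x|| < eps ||x||"  *)
(* is written as: some c < eps ||x|| bounds all ||pi(n)x - x||, n in Q. *)
Definition Kazhdan_set (R : realType) (Q : set int) : Prop :=
  exists eps : R, 0 < eps /\
    forall (V : lmodType R[i]) (ip : V -> V -> R[i]) (pi : int -> V -> V),
      is_Hilbert ip -> unitary_rep ip pi ->
      (exists x : V, exists c : R, c < eps * hnorm ip x /\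
          forall n : int, Q n -> hnorm ip (pi n x - x) <= c) ->
      exists y : V, y <> 0 /\ forall n : int, pi n y = y.

(* Borel probability measures on the circle T, represented through the *)
(* parametrization t |-> exp(2 i pi t), t in [0,1): a probability       *)
(* measure s on the Borel sets of R with s [0,1) = 1.                  *)
Definition circle_measure (R : realType) (s : probability R R) : Prop :=
  s `[0%R, 1%R[ = 1%E.

Definition continuous_measure (R : realType) (s : probability R R) : Prop :=
  forall t : R, s [set t] = 0%E.

Definition fourier_coef (R : realType) (s : probability R R) (n : int) : R[i] :=
  ((Rintegral s setT (fun t : R => cos (2 * pi * n%:~R * t)))
  +i* (Rintegral s setT (fun t : R => sin (2 * pi * n%:~R * t))))%C.

Definition modC (R : realType) (z : R[i]) : R :=
  Num.sqrt (complex.Re z ^+ 2 + complex.Im z ^+ 2).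

(* Q in delta-Ka^+ : exists a continuous probability measure s on T with
   inf_{n in Q} |hat s(n)| > delta, written as: some c > delta bounds
   all |hat s(n)|, n in Q, from below. *)
Definition delta_Ka_plus (R : realType) (delta : R) (Q : set int) : Prop :=
  exists s : probability R R,
    circle_measure s /\ continuous_measure s /\
    exists c : R, delta < c /\ forall n : int, Q n -> c <= modC (fourier_coef s n).

(* Main.v *)
Require Import Defs.
From HB Require Import structures.
From mathcomp Require Import all_boot all_order all_algebra.
From mathcomp Require Import all_classical all_reals.
From mathcomp Require Import topology normedtype sequences numfun derive realfun trigo
  measure measurable_realfun lebesgue_stieltjes_measure lebesgue_measure
  lebesgue_integral probability.
From mathcomp Require Import complex.
From mathcomp Require Import ring lra zify.
Import Order.TTheory GRing.Theory Num.Theory numFieldNormedType.Exports.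
Local Open Scope ring_scope.
Local Open Scope classical_set_scope.

Set Implicit Arguments.
Unset Strict Implicit.
Unset Printing Implicit Defensive.

(** All measures enter through their cosine coefficients, which are the
    real even positive definite functions on [int] (Herglotz).

    If [Q] is not a Kazhdan set, spectral measures of almost invariant vectors
    give probability measures [mu] with [mu {1} = 0] and cosine coefficients
    [psi] as close to 1 on [Q] as desired. Products of factors [(1 + psi) / 2]
    decrease pointwise, so an infinite product always converges to a positive
    definite function. The mean of [P * psi] is the integral of the masses of
    the atoms of [mu] against the measure of [P]; since [Q] generates the
    integers these masses tend to 0 when [psi] tends to 1 on [Q], so that each
    factor can be chosen to multiply the mean by at most 3/4. The limit then has
    mean 0, which by Wiener's lemma makes its measure continuous, while it stays
    close to 1 on [Q].

    Conversely, if [s] is a continuous measure, [|hat s|^2] is positive definite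
    with mean 0. On its reproducing kernel Hilbert space, translation is a
    unitary representation without invariant vectors (these would be the
    constant functions) and the kernel at 0 is moved by [n] by
    [2 - 2 |hat s(n)|^2] in squared norm. *)

(** * Integration of bounded measurable functions *)

(** A vanishing mean of coefficients a priori removes only the atom at 1, and Wiener's lemma in its
    usual form asks for means of squares. The factors [(1 + psi) / 2] are made for this: [psi] can
    be negative but the factor lies in [[0, 1]], and for nonnegative coefficients the mean against
    [cos (2 pi n t)] is at most the plain mean, so that mean 0 removes every atom. The half is paid
    for in the rate: if [P] has mean at most [a] and [P * psi] at most [a / 2], the new mean is at
    most [3 / 4 * a]. The spectral measures can have atoms anywhere except at 1, and the bound on
    their masses degenerates near 1; the masses tend to 0 pointwise, so each factor is chosen after
    the measure of the product so far, by dominated convergence. For the converse, the elements of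
    the Hilbert space are concrete functions on [int], so neither a quotient nor a completion has to
    be built. *)

Section BoundedMeasurable.
Context (d : measure_display) (T : measurableType d) (R : realType).
Implicit Types (mu : probability T R) (f g : T -> R).

Definition bmeas f := measurable_fun [set: T] f /\ exists M, forall t, `|f t| <= M.

Lemma bmeas_cst c : bmeas (fun=> c).
Proof. by split; [exact: measurable_cst|exists `|c|]. Qed.

Lemma bmeasD f g : bmeas f -> bmeas g -> bmeas (fun t => f t + g t).
Proof.
move=> [mf [M fM]] [mg [N gN]]; split; first exact: measurable_funD.
by exists (M + N) => t; rewrite (le_trans (ler_normD _ _)) // lerD.
Qed.

Lemma bmeasM f g : bmeas f -> bmeas g -> bmeas (fun t => f t * g t).
Proof.
move=> [mf [M fM]] [mg [N gN]]; split; first exact: measurable_funM.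
by exists (M * N) => t; rewrite normrM ler_pM.
Qed.

Lemma bmeasZ c f : bmeas f -> bmeas (fun t => c * f t).
Proof. by move=> bf; apply: bmeasM => //; exact: bmeas_cst. Qed.

Lemma bmeasB f g : bmeas f -> bmeas g -> bmeas (fun t => f t - g t).
Proof.
move=> bf /(bmeasZ (-1)) bg.
by under eq_fun do rewrite -mulN1r; exact: bmeasD.
Qed.

Lemma bmeas_sum (I : Type) (r : seq I) (F : I -> T -> R) :
  (forall i, bmeas (F i)) -> bmeas (fun t => \sum_(i <- r) F i t).
Proof.
move=> bF; elim: r => [|i r IH].
  by under eq_fun do rewrite big_nil; exact: bmeas_cst.
by under eq_fun do rewrite big_cons; exact: bmeasD.
Qed.

Lemma bmeas_indic (A : set T) : measurable A -> bmeas (\1_A : T -> R).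
Proof.
move=> mA; split; first exact: measurable_indic.
by exists 1 => t; rewrite indicE; case: (_ \in _); rewrite ?normr1 // normr0.
Qed.

Definition Ex mu f : R := Rintegral mu setT f.

Lemma bmeas_integrable mu f : bmeas f -> mu.-integrable setT (EFin \o f).
Proof.
move=> [mf [M fM]]; apply: measurable_bounded_integrable => //.
  by rewrite (le_lt_trans (@probability_le1 _ _ _ mu _ _))// ltry.
exists M; split; first exact: num_real.
by move=> x Mx t _; exact: (le_trans (fM t) (ltW Mx)).
Qed.

Lemma eq_Ex mu f g : f =1 g -> Ex mu f = Ex mu g.
Proof. by move=> fg; congr Rintegral; apply/funext. Qed.

Lemma Ex_cst mu c : Ex mu (fun=> c) = c.
Proof.
rewrite /Ex Rintegral_cst//; have := @probability_setT _ _ _ mu => /= ->.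
by rewrite mulr1.
Qed.

Lemma ExD mu f g : bmeas f -> bmeas g -> Ex mu (fun t => f t + g t) = Ex mu f + Ex mu g.
Proof. by move=> bf bg; apply: RintegralD => //; exact: bmeas_integrable. Qed.

Lemma ExB mu f g : bmeas f -> bmeas g -> Ex mu (fun t => f t - g t) = Ex mu f - Ex mu g.
Proof. by move=> bf bg; apply: RintegralB => //; exact: bmeas_integrable. Qed.

Lemma ExZ mu c f : bmeas f -> Ex mu (fun t => c * f t) = c * Ex mu f.
Proof. by move=> bf; apply: RintegralZl => //; exact: bmeas_integrable. Qed.

Lemma Ex_sum mu (I : Type) (r : seq I) (F : I -> T -> R) :
  (forall i, bmeas (F i)) ->
  Ex mu (fun t => \sum_(i <- r) F i t) = \sum_(i <- r) Ex mu (F i).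
Proof.
move=> bF; elim: r => [|i r IH].
  by rewrite big_nil -[RHS](Ex_cst mu); apply: eq_Ex => t; rewrite big_nil.
rewrite big_cons -IH -ExD//; last exact: bmeas_sum.
by apply: eq_Ex => t; rewrite big_cons.
Qed.

Lemma le_Ex mu f g : bmeas f -> bmeas g -> (forall t, f t <= g t) -> Ex mu f <= Ex mu g.
Proof. by move=> bf bg fg; apply: le_Rintegral => //; exact: bmeas_integrable. Qed.

Lemma Ex_ge0 mu f : (forall t, 0 <= f t) -> 0 <= Ex mu f.
Proof. by move=> f0; apply: Rintegral_ge0. Qed.

Lemma Ex_norm_le mu f M : bmeas f -> (forall t, `|f t| <= M) -> `|Ex mu f| <= M.
Proof.
move=> bf fM; rewrite ler_norml; apply/andP; split.
  rewrite -[leLHS](Ex_cst mu); apply: le_Ex => //; first exact: bmeas_cst.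
  by move=> t; have := fM t; rewrite ler_norml => /andP[].
rewrite -[leRHS](Ex_cst mu); apply: le_Ex => //; first exact: bmeas_cst.
by move=> t; have := fM t; rewrite ler_norml => /andP[].
Qed.

Lemma Ex_indic mu (A : set T) : measurable A -> Ex mu \1_A = fine (mu A).
Proof. by move=> mA; rewrite /Ex /Rintegral integral_indic// setIT. Qed.

Lemma bmeas_lim (fn : nat -> T -> R) f M : (forall n, bmeas (fn n)) ->
  (forall n t, `|fn n t| <= M) -> (forall t, fn ^~ t @ \oo --> f t) -> bmeas f.
Proof.
move=> bfn fnM fnf; split.
  by apply: (@measurable_fun_cvg _ _ _ setT fn) => // n; exact: (bfn n).1.
exists M => t; apply: (cvgr_to_le (cvg_norm (fnf t))).
by near=> n; exact: fnM.
Unshelve. all: by end_near. Qed.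

(** Bounded convergence: under a probability the constant [M] is an integrable majorant. Limits of
    Cesaro means pass under the integral in this way. *)
Lemma Ex_cvg mu (fn : nat -> T -> R) f M : (forall n, bmeas (fn n)) ->
  (forall n t, `|fn n t| <= M) -> (forall t, fn ^~ t @ \oo --> f t) ->
  Ex mu (fn n) @[n --> \oo] --> Ex mu f.
Proof.
move=> bfn fnM fnf; have bf := bmeas_lim bfn fnM fnf.
apply: fine_cvg; rewrite fineK; last exact/integrable_fin_num/bmeas_integrable.
have [] // := @dominated_convergence _ _ _ mu setT measurableT
   (fun n => EFin \o fn n) (EFin \o f) (EFin \o cst M).
- by move=> n; apply/measurable_EFinP; exact: (bfn n).1.
- by apply/measurable_EFinP; exact: bf.1.
- by apply: aeW => t _; apply: cvg_EFin; [near=> n|exact: fnf].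
- exact/bmeas_integrable/bmeas_cst.
- by apply: aeW => t n _ /=; rewrite lee_fin.
Unshelve. all: by end_near. Qed.

End BoundedMeasurable.

Lemma bmeas_continuous (R : realType) (f : R -> R) M : continuous f -> (forall t, `|f t| <= M) -> bmeas f.
Proof. by move=> cf fM; split; [exact: continuous_measurable_fun|exists M]. Qed.


(** * Characters of the circle, Cesaro means and the Dirichlet kernel *)

Section Trigonometric.
Variable R : realType.
Implicit Types (m n : int) (s t u : R).

Definition cosn n t : R := cos (2 * pi * n%:~R * t).
Definition sinn n t : R := sin (2 * pi * n%:~R * t).

Lemma cosnD m n t : cosn (m + n) t = cosn m t * cosn n t - sinn m t * sinn n t.
Proof. by rewrite /cosn intrD mulrDr mulrDl cosD. Qed.

Lemma sinnD m n t : sinn (m + n) t = sinn m t * cosn n t + cosn m t * sinn n t.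
Proof. by rewrite /sinn intrD mulrDr mulrDl sinD. Qed.

Lemma cosnN n t : cosn (- n) t = cosn n t.
Proof. by rewrite /cosn intrN mulrN mulNr cosN. Qed.

Lemma sinnN n t : sinn (- n) t = - sinn n t.
Proof. by rewrite /sinn intrN mulrN mulNr sinN. Qed.

Lemma cosnB m n t : cosn (m - n) t = cosn m t * cosn n t + sinn m t * sinn n t.
Proof. by rewrite cosnD cosnN sinnN mulrN opprK. Qed.

Lemma sinnB m n t : sinn (m - n) t = sinn m t * cosn n t - cosn m t * sinn n t.
Proof. by rewrite sinnD cosnN sinnN mulrN. Qed.

Lemma cosn0 t : cosn 0 t = 1.
Proof. by rewrite /cosn mulr0 mul0r cos0. Qed.

Lemma cosnDr n s t : cosn n (s + t) = cosn n s * cosn n t - sinn n s * sinn n t.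
Proof. by rewrite /cosn mulrDr cosD. Qed.

Lemma cosnBr n s t : cosn n (s - t) = cosn n s * cosn n t + sinn n s * sinn n t.
Proof. by rewrite /cosn mulrBr cosB. Qed.

Lemma cosnNr n t : cosn n (- t) = cosn n t.
Proof. by rewrite /cosn mulrN cosN. Qed.

Lemma sinn2cosn2 n t : sinn n t ^+ 2 = 1 - cosn n t ^+ 2.
Proof. exact: sin2cos2. Qed.

Lemma normr_cosn n t : `|cosn n t| <= 1.
Proof. exact: cos_max. Qed.

Lemma normr_sinn n t : `|sinn n t| <= 1.
Proof. exact: sin_max. Qed.

Lemma cosn_le1 n t : cosn n t <= 1.
Proof. exact: cos_le1. Qed.

Lemma cosn1_sinn n t : cosn n t = 1 -> sinn n t = 0.
Proof. by move=> c1; apply: cos1sin0; rewrite -/(cosn n t) c1 normr1. Qed.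

Lemma cosn1D m n t : cosn m t = 1 -> cosn n t = 1 -> cosn (m + n) t = 1.
Proof.
move=> cm cn; rewrite cosnD cm cn (cosn1_sinn cm) (cosn1_sinn cn).
by rewrite mulr0 subr0 mulr1.
Qed.

Lemma cosn1_eq1 n t : cosn 1 t = 1 -> cosn n t = 1.
Proof.
move=> c1; have posz (k : nat) : cosn k%:Z t = 1.
  by elim: k => [|k IH]; rewrite ?cosn0// intS cosn1D.
by case: (intP n) => [|k|k]; rewrite ?cosn0// ?cosnN posz.
Qed.

Lemma continuous_cosn n : continuous (cosn n).
Proof.
move=> t; rewrite /cosn; apply: continuous_comp; last exact: continuous_cos.
exact: mulrl_continuous.
Qed.

Lemma continuous_sinn n : continuous (sinn n).
Proof.
move=> t; rewrite /sinn; apply: continuous_comp; last exact: continuous_sin.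
exact: mulrl_continuous.
Qed.

Lemma bmeas_cosn n : bmeas (cosn n).
Proof. exact: bmeas_continuous (@continuous_cosn n) (normr_cosn n). Qed.

Lemma bmeas_sinn n : bmeas (sinn n).
Proof. exact: bmeas_continuous (@continuous_sinn n) (normr_sinn n). Qed.

Lemma bmeas_cosnB n t : bmeas (fun s => cosn n (s - t)).
Proof.
under eq_fun do rewrite cosnBr.
apply: bmeasD; apply: bmeasM; first [exact: bmeas_cosn|exact: bmeas_sinn|exact: bmeas_cst].
Qed.

Lemma cosn1_lt1 t : 0 < t < 1 -> cosn 1 t < 1.
Proof.
move=> /andP[t0 t1]; have -> : cosn 1 t = cos ((pi * t) *+ 2).
  by rewrite /cosn; congr cos; rewrite mulr2n; ring.
rewrite cos_mulr2n cos2sin2 mulr2n.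
have : 0 < sin (pi * t).
  by apply: sin_gt0_pi; rewrite mulr_gt0 ?pi_gt0//= -[ltRHS]mulr1 ltr_pM2l ?pi_gt0.
by move=> /(exprn_gt0 2) s0; lra.
Qed.

Lemma cosn1_inj s t : 0 <= s < 1 -> 0 <= t < 1 -> cosn 1 (s - t) = 1 -> s = t.
Proof.
move=> /andP[s0 s1] /andP[t0 t1] c1.
case: (ltgtP s t) => // st.
  have : cosn 1 (t - s) < 1 by apply: cosn1_lt1; apply/andP; split; lra.
  by rewrite -opprB cosnNr c1 ltxx.
have : cosn 1 (s - t) < 1 by apply: cosn1_lt1; apply/andP; split; lra.
by rewrite c1 ltxx.
Qed.

Definition avg (N : nat) (f : int -> R) : R := N%:R^-1 * \sum_(n < N) f n.

(* avgc + i avgs is the normalised Dirichlet kernel *)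
Definition avgc N u := avg N (cosn ^~ u).
Definition avgs N u := avg N (sinn ^~ u).

(** With [z = exp (2 i pi u)], this is the real part of [(1 - z^N) (1 - conj z)], the geometric sum
    times [|1 - z|^2 = 2 - 2 cosn 1 u]; [sum_sinn] is the imaginary part. *)
Lemma sum_cosn N u : (\sum_(n < N) cosn n u) * (2 - 2 * cosn 1 u) =
  1 - cosn 1 u + cosn (N%:Z - 1) u - cosn N u.
Proof.
elim: N => [|N IH]; first by rewrite big_ord0 sub0r cosnN cosn0; ring.
rewrite big_ord_recr /= mulrDl IH -[N.+1]addn1 PoszD addrK.
rewrite cosnB cosnD; ring.
Qed.

Lemma sum_sinn N u : (\sum_(n < N) sinn n u) * (2 - 2 * cosn 1 u) =
  sinn 1 u + sinn (N%:Z - 1) u - sinn N u.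
Proof.
elim: N => [|N IH].
  by rewrite big_ord0 sub0r sinnN {3}/sinn mulr0 mul0r sin0; ring.
rewrite big_ord_recr /= mulrDl IH -[N.+1]addn1 PoszD addrK.
rewrite sinnB sinnD; ring.
Qed.

Lemma avg_norm_le N f M : 0 <= M -> (forall n, `|f n| <= M) -> `|avg N f| <= M.
Proof.
move=> M0 fM; rewrite /avg normrM normfV normr_nat.
case: N => [|N]; first by rewrite invr0 mul0r.
rewrite ler_pdivrMl ?ltr0n//.
rewrite (le_trans (ler_norm_sum _ _ _))//.
rewrite (@le_trans _ _ (\sum_(i < N.+1) M))//; first exact: ler_sum.
by rewrite sumr_const card_ord mulr_natl.
Qed.

Lemma avg_bounded_cvg0 (f : int -> R) C :
  (forall N, `|\sum_(n < N) f n| <= C) -> avg N f @[N --> \oo] --> 0.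
Proof.
move=> fC; apply/norm_cvg0P.
apply: (@squeeze_cvgr _ _ _ _ (fun=> 0) (fun N : nat => C * N%:R^-1)).
- near=> N; rewrite normr_ge0 /= /avg normrM normfV normr_nat mulrC.
  by rewrite ler_wpM2r ?invr_ge0 ?ler0n.
- exact: cvg_cst.
- rewrite -[X in _ --> X](mulr0 C); apply: cvgMr.
  rewrite -(cvg_shiftS (fun n : nat => n%:R^-1 : R)); exact: cvg_harmonic.
Unshelve. all: by end_near. Qed.

(** The class of [t] modulo 1, that is one point of the circle; the cosine makes it the preimage of
    a point under a measurable function. *)
Definition cos1set t : set R := [set s | cosn 1 (s - t) = 1].

Lemma measurable_cos1set t : measurable (cos1set t).
Proof.
rewrite (_ : cos1set t = (fun s => cosn 1 (s - t)) @^-1` [set 1])//.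
rewrite -[X in measurable X]setTI.
exact: (bmeas_cosnB 1 t).1.
Qed.

(** On the class of [t] every term is 1; off it the Dirichlet sums stay bounded by [sum_cosn], so
    their means vanish. *)
Lemma avgc_cvg t s : avgc N (s - t) @[N --> \oo] --> (\1_(cos1set t) s : R).
Proof.
rewrite indicE; case: (asboolP (cosn 1 (s - t) = 1)) => c1.
  rewrite mem_set//=; apply: cvg_near_cst; near=> N.
  rewrite /avgc /avg; under eq_bigr do rewrite cosn1_eq1//.
  rewrite sumr_const card_ord mulVf// pnatr_eq0 -lt0n.
  by near: N; exact: nbhs_infty_gt.
rewrite memNset//=; apply: (@avg_bounded_cvg0 _ (4 / (2 - 2 * cosn 1 (s - t)))) => N.
have d0 : 0 < 2 - 2 * cosn 1 (s - t).
  have := cosn_le1 1 (s - t); rewrite le_eqVlt => /orP[/eqP//|]; lra.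
rewrite ler_pdivlMr// -[X in _ * X]gtr0_norm// -normrM sum_cosn.
move: (normr_cosn 1 (s - t)) (normr_cosn (N%:Z - 1) (s - t)) (normr_cosn N (s - t)).
by rewrite !ler_norml => /andP[? ?] /andP[? ?] /andP[? ?]; lra.
Unshelve. all: by end_near. Qed.

Lemma avgs_cvg u : avgs N u @[N --> \oo] --> (0 : R).
Proof.
case: (asboolP (cosn 1 u = 1)) => c1.
  apply: (@avg_bounded_cvg0 _ 0) => N.
  by rewrite big1 ?normr0// => i _; rewrite (cosn1_sinn (cosn1_eq1 _ c1)).
apply: (@avg_bounded_cvg0 _ (4 / (2 - 2 * cosn 1 u))) => N.
have d0 : 0 < 2 - 2 * cosn 1 u.
  have := cosn_le1 1 u; rewrite le_eqVlt => /orP[/eqP//|]; lra.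
rewrite ler_pdivlMr// -[X in _ * X]gtr0_norm// -normrM sum_sinn.
move: (normr_sinn 1 u) (normr_sinn (N%:Z - 1) u) (normr_sinn N u).
by rewrite !ler_norml => /andP[? ?] /andP[? ?] /andP[? ?]; lra.
Qed.

End Trigonometric.

Arguments cosn {R} n t.
Arguments sinn {R} n t.

(** * Positive functionals on the circle *)

Section PositiveFunctional.
Variable R : realType.

Definition bfun (f : R -> R) := exists M, forall t, `|f t| <= M.

Lemma bfun_cst c : bfun (fun=> c).
Proof. by exists `|c|. Qed.

Lemma bfunD f g : bfun f -> bfun g -> bfun (fun t => f t + g t).
Proof.
move=> [M fM] [N gN]; exists (M + N) => t.
by rewrite (le_trans (ler_normD _ _)) // lerD.
Qed.

Lemma bfunZ c f : bfun f -> bfun (fun t => c * f t).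
Proof. by move=> [M fM]; exists (`|c| * M) => t; rewrite normrM ler_wpM2l. Qed.

Lemma bfun_bool (b : R -> bool) : bfun (fun t => (b t)%:R).
Proof. by exists 1 => t; case: (b t); rewrite ?normr1 ?normr0. Qed.

Lemma bfunB f g : bfun f -> bfun g -> bfun (fun t => f t - g t).
Proof.
move=> bf /(bfunZ (-1)) bg.
by under eq_fun do rewrite -mulN1r; exact: bfunD.
Qed.

Lemma bfun_sum (I : Type) (r : seq I) (F : I -> R -> R) :
  (forall i, bfun (F i)) -> bfun (fun t => \sum_(i <- r) F i t).
Proof.
move=> bF; elim: r => [|i r IH].
  by under eq_fun do rewrite big_nil; exact: bfun_cst.
by under eq_fun do rewrite big_cons; exact: bfunD.
Qed.

(** Acts on all bounded functions, measurable or not, hence on indicators of half-lines; it is a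
    finitely additive mean, with no continuity along sequences. Positivity tested on [[0, 1)] says
    that it is carried by the circle. *)
Record pos_functional (L : (R -> R) -> R) : Prop := PosFunctional {
  pfD : forall f g, bfun f -> bfun g -> L (fun t => f t + g t) = L f + L g ;
  pfZ : forall c f, bfun f -> L (fun t => c * f t) = c * L f ;
  pf_ge0 : forall f, bfun f -> (forall t, 0 <= t < 1 -> 0 <= f t) -> 0 <= L f ;
  pf1 : L (fun=> 1) = 1 }.

Section Theory.
Context (L : (R -> R) -> R) (Lpos : pos_functional L).

Let LZ := pfZ Lpos.
Let LD := pfD Lpos.

Lemma pfB f g : bfun f -> bfun g -> L (fun t => f t - g t) = L f - L g.
Proof.
move=> bf bg; under eq_fun do rewrite -mulN1r.
by rewrite LD ?LZ ?mulN1r//; exact: bfunZ.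
Qed.

Lemma pf_le f g : bfun f -> bfun g -> (forall t, 0 <= t < 1 -> f t <= g t) -> L f <= L g.
Proof.
move=> bf bg fg; rewrite -subr_ge0 -pfB//; apply: (pf_ge0 Lpos); first exact: bfunB.
by move=> t /fg; rewrite subr_ge0.
Qed.

Lemma pf_cst c : L (fun=> c) = c.
Proof.
rewrite -[RHS]mulr1 -(pf1 Lpos) -LZ; last exact: bfun_cst.
by under [in RHS]eq_fun do rewrite mulr1.
Qed.

Lemma pf_eq f g : bfun f -> bfun g -> (forall t, 0 <= t < 1 -> f t = g t) -> L f = L g.
Proof.
move=> bf bg fg; apply/eqP; rewrite eq_le.
by apply/andP; split; apply: pf_le => // t t01; rewrite fg.
Qed.

Lemma pf_sum (I : Type) (r : seq I) (F : I -> R -> R) :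
  (forall i, bfun (F i)) ->
  L (fun t => \sum_(i <- r) F i t) = \sum_(i <- r) L (F i).
Proof.
move=> bF; elim: r => [|i r IH].
  by under eq_fun do rewrite big_nil; rewrite big_nil pf_cst.
under eq_fun do rewrite big_cons.
by rewrite LD ?IH ?big_cons//; exact: bfun_sum.
Qed.

Lemma pf_dist_le f g e : bfun f -> bfun g ->
  (forall t, 0 <= t < 1 -> `|f t - g t| <= e) -> `|L f - L g| <= e.
Proof.
move=> bf bg fge; rewrite -pfB// ler_norml.
have bfg := bfunB bf bg.
apply/andP; split; [rewrite -[leLHS]pf_cst|rewrite -[leRHS]pf_cst];
  by apply: pf_le => //; try exact: bfun_cst; move=> t /fge; rewrite ler_norml => /andP[].
Qed.

Definition fcdf (t : R) := L (fun s => (s <= t)%R%:R).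

Lemma fcdf_homo : {homo fcdf : x y / x <= y}.
Proof.
move=> x y xy; apply: pf_le; try exact: bfun_bool.
by move=> t _; rewrite ler_nat; case: leP => // tx; rewrite (le_trans tx xy).
Qed.

Lemma fcdf_lt0 t : t < 0 -> fcdf t = 0.
Proof.
move=> t0; rewrite -(pf_cst 0); apply: pf_eq; [exact: bfun_bool|exact: bfun_cst|].
by move=> s /andP[s0 _]; rewrite leNgt (lt_le_trans t0 s0).
Qed.

Lemma fcdf_ge1 t : 1 <= t -> fcdf t = 1.
Proof.
move=> t1; rewrite -(pf_cst 1); apply: pf_eq; [exact: bfun_bool|exact: bfun_cst|].
by move=> s /andP[_ s1]; rewrite (le_trans (ltW s1) t1).
Qed.

Lemma fcdf_ge0 t : 0 <= fcdf t.
Proof. by apply: (pf_ge0 Lpos) => [|s _]; [exact: bfun_bool|rewrite ler0n]. Qed.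

(** Finite additivity does not make [fcdf] right continuous; this is its right-continuous
    regularisation, as a Stieltjes function must be. *)
Definition rcdf t := inf (fcdf @` [set u | t < u]).

Let rcdf_has_inf t : has_inf (fcdf @` [set u | t < u]).
Proof.
split; first by exists (fcdf (t + 1)), (t + 1) => //=; rewrite ltrDl.
by exists 0 => _ [u _ <-]; exact: fcdf_ge0.
Qed.

Lemma rcdf_le t u : t < u -> rcdf t <= fcdf u.
Proof. by move=> tu; apply: ge_inf; [exact: (rcdf_has_inf t).2|exists u]. Qed.

Lemma rcdf_ge t : fcdf t <= rcdf t.
Proof.
apply: lb_le_inf; first exact: (rcdf_has_inf t).1.
by move=> _ [u tu <-]; apply/fcdf_homo/ltW.
Qed.

Lemma rcdf_homo : {homo rcdf : x y / x <= y}.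
Proof.
move=> x y xy; apply: lb_le_inf; first exact: (rcdf_has_inf y).1.
by move=> _ [u yu <-]; apply: rcdf_le; exact: le_lt_trans yu.
Qed.

Lemma rcdf_right_continuous : right_continuous rcdf.
Proof.
move=> x; apply/cvgrPdist_le => e e0.
have [_ [u /= xu <-] Gu] := inf_adherent e0 (rcdf_has_inf x).
near=> y.
have xy : x < y by near: y; exact: nbhs_right_gt.
rewrite distrC ger0_norm; last by rewrite subr_ge0; apply/rcdf_homo/ltW.
rewrite lerBlDl (le_trans _ (ltW Gu))//; apply: rcdf_le.
by near: y; exact: nbhs_right_lt.
Unshelve. all: by end_near. Qed.

Lemma rcdf_lt0 t : t < 0 -> rcdf t = 0.
Proof.
move=> t0; apply/eqP; rewrite eq_le (le_trans (fcdf_ge0 _) (rcdf_ge _)) andbT.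
rewrite -(@fcdf_lt0 (t / 2)); first by apply: rcdf_le; lra.
lra.
Qed.

Lemma rcdf_ge1 t : 1 <= t -> rcdf t = 1.
Proof.
move=> t1; apply/eqP; rewrite eq_le -{2}(fcdf_ge1 t1) rcdf_ge andbT.
rewrite -(@fcdf_ge1 (t + 1)); first by apply: rcdf_le; rewrite ltrDl.
lra.
Qed.

Lemma rcdfNy : rcdf @ -oo --> (0 : R).
Proof.
apply: cvg_near_cst; near=> x; apply: rcdf_lt0.
by near: x; exact: nbhs_ninfty_lt.
Unshelve. all: by end_near. Qed.

Lemma rcdfy : rcdf @ +oo --> (1 : R).
Proof.
apply: cvg_near_cst; near=> x; apply: rcdf_ge1.
by near: x; exact: nbhs_pinfty_ge.
Unshelve. all: by end_near. Qed.

HB.instance Definition _ := isCumulative.Build R _ R rcdf rcdf_homo rcdf_right_continuous.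
HB.instance Definition _ := isCumulativeBounded.Build R 0 1 rcdf rcdfNy rcdfy.

Let P0 : probability (measurableTypeR R) R :=
  lebesgue_stieltjes_measure (rcdf : cumulativeBounded 0 1).

Let P0_oc a b : a <= b -> P0 `]a, b] = (rcdf b - rcdf a)%:E.
Proof.
move=> ab; rewrite /P0 /= /lebesgue_stieltjes_measure.
rewrite /measure_extension measurable_mu_extE/=; last exact: is_ocitv.
by rewrite wlength_itv_bnd.
Qed.


(** [P0] is carried by [[0, 1]] and can charge 1, where mass of [L] may accumulate from the left.
    Folding 1 onto 0 brings it back to [[0, 1)] and is invisible to [g] with [g 0 = g 1]. *)
Let tau (t : measurableTypeR R) : R := if 0 <= t < 1 then t else 0.

Let tau01 t : 0 <= tau t < 1.
Proof. by rewrite /tau; case: ifP => // _; rewrite lexx ltr01. Qed.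

Let tau_id t : 0 <= t < 1 -> tau t = t.
Proof. by rewrite /tau => ->. Qed.

Let measurable_tau : measurable_fun [set: measurableTypeR R] tau.
Proof.
have -> : tau = (fun t : measurableTypeR R => (\1_(`[0, 1[ : set R) t : R) * (t : R)).
  apply/funext => t; rewrite /tau indicE mem_setE in_itv /=.
  by case: ifP; rewrite ?mul1r ?mul0r.
apply: measurable_funM.
  have := @measurable_indic _ R R setT `[0, 1[ (measurable_itv _).
  exact.
by move=> _ A mA; rewrite setTI.
Qed.

HB.instance Definition _ := @isMeasurableFun.Build _ _ _ _ tau measurable_tau.

Let P : probability R R := distribution P0 tau.

Let P_circle : circle_measure P.
Proof.
rewrite /circle_measure /= /distribution /pushforward.
rewrite (_ : _ @^-1` _ = setT) ?probability_setT//.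
by apply/seteqP; split => // t _ /=; rewrite in_itv /= tau01.
Qed.

Let ExP g : bmeas g -> Ex P g = Ex P0 (g \o tau).
Proof.
move=> bg; rewrite /Ex /Rintegral; congr fine.
rewrite (integral_distribution (X := tau))//.
  by apply/measurable_EFinP; exact: bg.1.
apply: bmeas_integrable; split; first exact: measurableT_comp bg.1 _.
by have [M gM] := bg.2; exists M => t; exact: gM.
Qed.

Let bmeas_le (a : R) : bmeas (fun t : measurableTypeR R => (t <= a)%R%:R : R).
Proof.
rewrite (_ : (fun _ => _) = \1_(`]-oo, a] : set (measurableTypeR R))).
  by apply: bmeas_indic; exact: measurable_itv.
by apply/funext => t; rewrite indicE mem_setE in_itv.
Qed.

Let Ex_cell (a b : R) : a <= b ->
  Ex P0 (fun t => (t <= b)%R%:R - (t <= a)%R%:R) = rcdf b - rcdf a.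
Proof.
move=> ab; rewrite -[RHS]/(fine (rcdf b - rcdf a)%:E) -(P0_oc ab).
rewrite -(Ex_indic P0); last exact: measurable_itv.
apply: eq_Ex => t; rewrite indicE mem_setE in_itv /=.
case: (leP t b) => tb; case: (leP t a) => ta; rewrite ?subrr ?subr0//=.
by have := le_lt_trans ta (le_lt_trans ab tb); rewrite ltxx.
Qed.

(** * Step functions comparing the functional with its Stieltjes measure *)

Section RiemannSum.
Context (g : R -> R) (K : R) (bg : bmeas g).
Context (gK : forall x y, `|g x - g y| <= K * `|x - y|) (g01 : g 0 = g 1) (m : nat).

Let h : R := m.+1%:R^-1.
(** The grid starts at [- h], so that the first half-open cell []- h, 0]] catches the mass at 0; the
    last of the [m + 2] cells ends at 1. *)
Let a (i : nat) : R := (i%:R - 1) * h.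
Let h0 : 0 < h. Proof. by rewrite invr_gt0 ltr0n. Qed.
Let aS i : a i.+1 = a i + h.
Proof. by rewrite /a -natr1; ring. Qed.
Let a0 : a 0 < 0. Proof. by rewrite /a; have := h0; lra. Qed.
Let a_last : a m.+2 = 1.
Proof. by rewrite /a -natr1 addrK /h mulfV// pnatr_eq0. Qed.
Let K0 : 0 <= K.
Proof. by have := gK 1 0; rewrite subr0 normr1 mulr1; apply: le_trans. Qed.

Let cell i (t : R) : R := (t <= a i.+1)%R%:R - (t <= a i)%R%:R.
Let step t := \sum_(i < m.+2) g (a i.+1) * cell i t.

Let cell_ge0 i t : 0 <= cell i t.
Proof.
rewrite subr_ge0 ler_nat aS; case: leP => // ta.
by rewrite (le_trans ta)// lerDl ltW.
Qed.

Let sum_cell t : a 0 < t <= 1 -> \sum_(i < m.+2) cell i t = 1.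
Proof.
move=> /andP[t0 t1]; rewrite -(big_mkord xpredT (fun i => cell i t)).
by rewrite telescope_sumr// a_last t1 leNgt t0 subr0.
Qed.

(** The cells form a partition of unity, so [x - step t] is an average of the [x - g (a i.+1)] in
    which only the cell containing [t] has weight. *)
Let step_close (x t : R) : a 0 < t <= 1 ->
  (forall i, a i < t <= a i.+1 -> `|x - g (a i.+1)| <= K * h) -> `|x - step t| <= K * h.
Proof.
move=> t01 xg; rewrite -[x]mulr1 -(sum_cell t01) mulr_sumr -sumrB.
rewrite (le_trans (ler_norm_sum _ _ _))// -[leRHS]mulr1 -(sum_cell t01) mulr_sumr.
apply: ler_sum => i _; rewrite -mulrBl normrM (ger0_norm (cell_ge0 _ _)).
have [/andP[ti1 ti2]|] := boolP (a i < t <= a i.+1).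
  by rewrite ler_wpM2r// xg// ti1.
rewrite negb_and -leNgt -ltNge => ti.
suff -> : cell i t = 0 by rewrite !mulr0.
rewrite /cell.
case/orP: ti => ti.
  have ti' : t <= a i.+1 by rewrite aS (le_trans ti)// lerDl ltW.
  by rewrite ti ti' subrr.
have ti' : a i < t by rewrite (lt_trans _ ti)// aS ltrDl.
by rewrite leNgt ti leNgt ti' subrr.
Qed.

Let bfun_step : bfun step.
Proof.
by apply: bfun_sum => i; apply: bfunZ; apply: bfunB; exact: bfun_bool.
Qed.

Let bmeas_step : bmeas (step : measurableTypeR R -> R).
Proof.
by apply: bmeas_sum => i; apply: bmeasZ; apply: bmeasB; exact: bmeas_le.
Qed.

Let pf_step : `|L g - L step| <= K * h.
Proof.
apply: pf_dist_le => //; first exact: bg.2.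
move=> t /andP[t0 t1]; apply: step_close; first by rewrite (lt_le_trans a0 t0) ltW.
move=> i /andP[ai1 ai2]; rewrite (le_trans (gK _ _))// ler_wpM2l//.
by rewrite distrC ger0_norm ?subr_ge0// lerBlDl -lerBlDr; rewrite aS in ai2 *; lra.
Qed.

Let Ex_step : `|Ex P0 (g \o tau) - Ex P0 step| <= K * h.
Proof.
have bgt : bmeas (g \o tau).
  split; first exact: measurableT_comp bg.1 _.
  by have [M gM] := bg.2; exists M => t; exact: gM.
have bd := bmeasB bgt bmeas_step.
have [C gC] := bd.2.
(* Outside []a 0, 1]] the step function approximates nothing, but this set is null for [P0], so the
   crude bound [C] costs nothing there. *)
pose out : measurableTypeR R -> R := fun t => 1 - \1_(`]a 0, 1] : set (measurableTypeR R)) t.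
have bout : bmeas out.
  apply: bmeasB; first exact: bmeas_cst.
  by apply: bmeas_indic; exact: measurable_itv.
have Eout : Ex P0 out = 0.
  rewrite ExB; [|exact: bmeas_cst|by apply: bmeas_indic; exact: measurable_itv].
  rewrite Ex_cst Ex_indic; last exact: measurable_itv.
  rewrite P0_oc /=; last by rewrite (le_trans (ltW a0)).
  by rewrite rcdf_ge1// rcdf_lt0// subr0 subrr.
have bb : bmeas (fun t => K * h + C * out t).
  by apply: bmeasD; [exact: bmeas_cst|exact: bmeasZ].
have Ebb : Ex P0 (fun t => K * h + C * out t) = K * h.
  rewrite ExD; [|exact: bmeas_cst|exact: bmeasZ].
  by rewrite Ex_cst ExZ// Eout mulr0 addr0.
have bnd t : `|g (tau t) - step t| <= K * h + C * out t.
  rewrite /out indicE mem_setE in_itv /=.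
  have [t01|_] := boolP (a 0 < t <= 1); last first.
    by rewrite subr0 mulr1 (le_trans (gC t))// lerDr mulr_ge0// ltW.
  rewrite subrr mulr0 addr0; apply: step_close => // i /andP[ai1 ai2].
  have [t0|t0] := ltP t 0.
    (* Left of 0 only the first cell is met, and [tau t] is exactly its right end [a 1 = 0]. *)
    have -> : tau t = 0 by rewrite /tau [0 <= t]leNgt t0.
    have i0 : i = 0%N.
      case: i ai1 {ai2} => // i ai1; have : 0 < a i.+1 + h.
        by rewrite /a -natr1 addrK ltr_wpDl// mulr_ge0// ltW.
      have : 0 <= a i.+1 by rewrite /a -natr1 addrK mulr_ge0// ltW.
      by move=> /le_lt_trans /(_ ai1) /lt_trans /(_ t0); rewrite ltxx.
    by rewrite i0 /a subrr mul0r subrr normr0 mulr_ge0// ltW.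
  have [t1|t1] := ltP t 1.
    rewrite tau_id ?t0// (le_trans (gK _ _))// ler_wpM2l//.
    by rewrite distrC ger0_norm ?subr_ge0//; rewrite aS in ai2 *; lra.
  have -> : g (tau t) = g t.
    rewrite /tau t0 [t < 1]ltNge t1 /= g01; congr g.
    by apply/eqP; rewrite eq_le t1; case/andP: t01.
  rewrite (le_trans (gK _ _))// ler_wpM2l//.
  by rewrite distrC ger0_norm ?subr_ge0//; rewrite aS in ai2 *; lra.
rewrite -ExB// ler_norml -{1}Ebb -{2}Ebb; apply/andP; split.
  rewrite -mulN1r -ExZ//; apply: le_Ex => //; first exact: bmeasZ.
  by move=> t; rewrite mulN1r; have := bnd t; rewrite ler_norml => /andP[].
by apply: le_Ex => // t; have := bnd t; rewrite ler_norml => /andP[].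
Qed.

Lemma abel_sum (u D : nat -> R) n :
  \sum_(i < n) u i.+1 * (D i.+1 - D i) =
  u n * D n - u 0%N * D 0%N - \sum_(i < n) (u i.+1 - u i) * D i.
Proof.
elim: n => [|n IH]; first by rewrite !big_ord0; ring.
by rewrite !big_ord_recr /= IH; ring.
Qed.

(** The gap [D = rcdf - fcdf] vanishes at both ends of the grid, and Abel summation moves the
    difference onto [g], whose increments are at most [K * h]. Since [fcdf (a i) <= rcdf (a i) <=
    fcdf (a i.+1)], the gaps are bounded by increments of [fcdf], which add up to 1. *)
Let steps_close : `|Ex P0 step - L step| <= K * h.
Proof.
have -> : Ex P0 step = \sum_(i < m.+2) g (a i.+1) * (rcdf (a i.+1) - rcdf (a i)).
  rewrite Ex_sum; last by move=> i; apply: bmeasZ; apply: bmeasB; exact: bmeas_le.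
  apply: eq_bigr => i _; rewrite ExZ; last by apply: bmeasB; exact: bmeas_le.
  by rewrite Ex_cell// aS lerDl ltW.
have -> : L step = \sum_(i < m.+2) g (a i.+1) * (fcdf (a i.+1) - fcdf (a i)).
  rewrite pf_sum; last by move=> i; apply: bfunZ; apply: bfunB; exact: bfun_bool.
  apply: eq_bigr => i _; rewrite LZ; last by apply: bfunB; exact: bfun_bool.
  by rewrite pfB//; exact: bfun_bool.
rewrite -sumrB; pose D i := rcdf (a i) - fcdf (a i).
rewrite (eq_bigr (fun i : 'I_m.+2 => g (a i.+1) * (D i.+1 - D i))); last first.
  by move=> i _; rewrite /D; ring.
rewrite (abel_sum (g \o a) D) /= {1 2}/D a_last rcdf_ge1// fcdf_ge1//.
rewrite rcdf_lt0// fcdf_lt0// !subrr !mulr0 subrr sub0r normrN.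
rewrite (le_trans (ler_norm_sum _ _ _))//.
apply: (@le_trans _ _ (\sum_(i < m.+2) K * h * (fcdf (a i.+1) - fcdf (a i)))).
  apply: ler_sum => i _; rewrite normrM; apply: ler_pM => //.
    by rewrite (le_trans (gK _ _))// aS addrAC subrr add0r gtr0_norm.
  rewrite ger0_norm ?subr_ge0 ?rcdf_ge// lerD2r rcdf_le//.
  by rewrite aS ltrDl.
rewrite -mulr_sumr -(big_mkord xpredT (fun i => fcdf (a i.+1) - fcdf (a i))).
by rewrite telescope_sumr// a_last fcdf_ge1// fcdf_lt0// subr0 mulr1.
Qed.

Lemma riemann_sum_close : `|Ex P g - L g| <= 3 * (K * m.+1%:R^-1).
Proof.
rewrite ExP// -/h.
move: Ex_step steps_close pf_step; rewrite !ler_norml.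
by move=> /andP[? ?] /andP[? ?] /andP[? ?]; apply/andP; split; lra.
Qed.

End RiemannSum.
(** The two sides differ by at most [3 * K / (m + 1)] for every grid. Lipschitz periodic test
    functions cover the cosines, for which the result is wanted. *)
Lemma riesz_circle : exists s : probability R R, circle_measure s /\
  forall (g : R -> R) (K : R), bmeas g ->
    (forall x y, `|g x - g y| <= K * `|x - y|) -> g 0 = g 1 -> Ex s g = L g.
Proof.
exists P; split=> // g K bg gK g01; apply/eqP; rewrite -subr_eq0 -normr_le0.
have cv0 : 3 * (K * m.+1%:R^-1) @[m --> \oo] --> (3 * (K * 0) : R).
  by do 2!apply: cvgMr; exact: cvg_harmonic.
rewrite !mulr0 in cv0; apply: (cvgr_to_ge cv0).
by near=> m; exact: riemann_sum_close.
Unshelve. all: by end_near. Qed.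

End Theory.
End PositiveFunctional.

Lemma cvg_sumr (R : realType) (T I : Type) (F : set_system T) (FF : Filter F)
    (r : seq I) (f : I -> T -> R) (l : I -> R) :
  (forall i, f i @ F --> l i) ->
  \sum_(i <- r) f i x @[x --> F] --> (\sum_(i <- r) l i : R).
Proof.
move=> fl; elim: r => [|i r IH].
  by rewrite big_nil; under eq_fun do rewrite big_nil; exact: cvg_cst.
by rewrite big_cons; under eq_fun do rewrite big_cons; exact: cvgD.
Qed.

(** * Positive definite functions and Herglotz's theorem *)

Section PositiveDefinite.
Variable R : realType.
Implicit Types (phi : int -> R) (v w : seq (R * int)).

(** A list of pairs (weight, point) stands for a finitely supported signed measure on [int]. Points
    may repeat, so concatenation is addition of measures. *)
Definition qform phi v : R := \sum_(p <- v) \sum_(q <- v) p.1 * q.1 * phi (p.2 - q.2).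

Definition posdef phi := (forall n, phi (- n) = phi n) /\ forall v, 0 <= qform phi v.

(** The addition formula for [cosn (m - n) t] splits the form into two forms of [phi], with weights
    multiplied by cosines and by sines. *)
Lemma posdef_cosnM phi t : posdef phi -> posdef (fun n => phi n * cosn n t).
Proof.
move=> [phiN phi0]; split=> [n|v]; first by rewrite phiN cosnN.
pose vc := [seq (p.1 * cosn p.2 t, p.2) | p <- v].
pose vs := [seq (p.1 * sinn p.2 t, p.2) | p <- v].
suff -> : qform (fun n => phi n * cosn n t) v = qform phi vc + qform phi vs.
  by rewrite addr_ge0.
rewrite /qform !big_map -big_split /=; apply: eq_bigr => p _.
rewrite !big_map -big_split /=; apply: eq_bigr => q _.
by rewrite cosnB; ring.
Qed.

(** Schur's product theorem when one factor is given by a measure: integrate [posdef_cosnM] over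
    [t]. *)
Lemma posdef_ExM phi (mu : probability R R) :
  posdef phi -> posdef (fun n => phi n * Ex mu (cosn n)).
Proof.
move=> pd; split=> [n|v].
  by rewrite pd.1; congr (_ * _); apply: eq_Ex => t; rewrite cosnN.
suff -> : qform (fun n => phi n * Ex mu (cosn n)) v =
    Ex mu (fun t => qform (fun n => phi n * cosn n t) v).
  by apply: Ex_ge0 => t; exact: (posdef_cosnM t pd).2.
have bm (a : R) n : bmeas (fun t => a * (phi n * cosn n t)).
  by do 2!apply: bmeasZ; exact: bmeas_cosn.
rewrite Ex_sum; last by move=> p; apply: bmeas_sum => q.
apply: eq_bigr => p _; rewrite Ex_sum//.
apply: eq_bigr => q _; rewrite !ExZ//; first exact: bmeas_cosn.
by apply: bmeasZ; exact: bmeas_cosn.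
Qed.

Lemma posdefD phi psi : posdef phi -> posdef psi -> posdef (fun n => phi n + psi n).
Proof.
move=> [phiN phi0] [psiN psi0]; split=> [n|v]; first by rewrite phiN psiN.
suff -> : qform (fun n => phi n + psi n) v = qform phi v + qform psi v.
  by rewrite addr_ge0.
rewrite /qform -big_split /=; apply: eq_bigr => p _.
by rewrite -big_split /=; apply: eq_bigr => q _; rewrite mulrDr.
Qed.

Lemma posdefZ c phi : 0 <= c -> posdef phi -> posdef (fun n => c * phi n).
Proof.
move=> c0 [phiN phi0]; split=> [n|v]; first by rewrite phiN.
suff -> : qform (fun n => c * phi n) v = c * qform phi v by rewrite mulr_ge0.
rewrite /qform mulr_sumr; apply: eq_bigr => p _.
by rewrite mulr_sumr; apply: eq_bigr => q _; rewrite mulrCA.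
Qed.

Lemma posdef1 : posdef (fun=> 1).
Proof.
split=> // v; suff -> : qform (fun=> 1) v = (\sum_(p <- v) p.1) ^+ 2 by rewrite sqr_ge0.
rewrite /qform expr2 mulr_suml; apply: eq_bigr => p _.
by rewrite mulr_sumr; apply: eq_bigr => q _; rewrite mulr1.
Qed.

Lemma posdef_lim (phi_ : nat -> int -> R) phi : (forall k, posdef (phi_ k)) ->
  (forall n, phi_ ^~ n @ \oo --> phi n) -> posdef phi.
Proof.
move=> pd cv; split=> [n|v].
  have := cv (- n); under eq_fun do rewrite (pd _).1.
  by move=> cvN; apply: (cvg_unique _ cvN (cv n)).
have cvq : qform (phi_ k) v @[k --> \oo] --> qform phi v.
  by apply: cvg_sumr => p; apply: cvg_sumr => q; apply: cvgMr; exact: cv.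
by apply: (cvgr_to_ge cvq); near=> k; exact: (pd k).2.
Unshelve. all: by end_near. Qed.

Lemma cosn1r n : cosn n (1 : R) = 1.
Proof.
apply: cosn1_eq1; rewrite /cosn (_ : _ * _ = pi *+ 2) ?cos2pi//.
by rewrite mulr2n; ring.
Qed.

(** Orthogonality of the characters of the cyclic group of order [M]; the bound on [l] excludes
    nonzero multiples of [M]. *)
Lemma sum_cosn_root (M : nat) (l : int) : (0 < M)%N -> (`|l| < M)%N ->
  \sum_(j < M) cosn l (j%:R / M%:R) = (M * (l == 0%R))%:R :> R.
Proof.
move=> M0 lM; have [->|l0] := eqVneq l 0.
  by under eq_bigr do rewrite cosn0; rewrite sumr_const card_ord muln1.
rewrite muln0; pose u : R := l%:~R / M%:R.
have Mn0 : M%:R != 0 :> R by rewrite pnatr_eq0 -lt0n.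
(* Frequency and sample point are exchanged, [l * (j / M) = j * (l / M)], which turns the sum into a
   Dirichlet sum at [u]. *)
rewrite (eq_bigr (fun j : 'I_M => cosn j u)); last first.
  by move=> j _; rewrite /cosn /u -pmulrn; congr cos; ring.
have cM : cosn M u = 1.
  rewrite -[RHS](cosn1r l) /cosn; congr cos.
  by rewrite /u -pmulrn; field.
have d0 : 2 - 2 * cosn 1 u != 0.
  have : cosn 1 `|u| < 1.
    apply: cosn1_lt1; rewrite normr_gt0 mulf_neq0 ?intr_eq0 ?invr_eq0//=.
    rewrite normrM normfV normr_nat ltr_pdivrMr ?ltr0n// mul1r -intr_norm.
    by rewrite -[M%:R]/(M%:~R) ltr_int.
  have -> : cosn 1 `|u| = cosn 1 u by case: (ger0P u) => _; rewrite ?cosnNr.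
  by move=> c1; apply/eqP; lra.
apply: (mulIf d0); rewrite sum_cosn cosnB cM (cosn1_sinn cM); ring.
Qed.

End PositiveDefinite.

Lemma cos_lipschitz (R : realType) (a b : R) : `|cos a - cos b| <= `|a - b|.
Proof.
wlog ab : a b / b <= a.
  by move=> H; case: (leP b a) => [/H//|/ltW/H]; rewrite distrC [in leRHS]distrC.
have dc x : x \in `]b, a[%R -> is_derive x 1 cos (- sin x) by move=> _; exact: is_derive_cos.
have cc : {within `[b, a], continuous (@cos R)}.
  by apply: continuous_subspaceT; exact: continuous_cos.
have [c _ ->] := MVT_segment ab dc cc.
by rewrite normrM normrN ler_piMl// sin_max.
Qed.

Lemma cosn_lipschitz (R : realType) n (x y : R) :
  `|cosn n x - cosn n y| <= `|2 * pi * n%:~R| * `|x - y|.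
Proof. by rewrite (le_trans (cos_lipschitz _ _))// -mulrBr normrM. Qed.

Lemma ultra_fmap (T U : Type) (f : T -> U) (F : set_system T) :
  UltraFilter F -> UltraFilter (f @ F).
Proof.
move=> FU; have FP : ProperFilter F by exact: ultra_proper.
split; first exact: fmap_proper_filter.
move=> G GP FG; apply/seteqP; split=> // A GA.
have [//|FnA] := in_ultra_setVsetC (f @^-1` A) FU.
have GnA : G (~` A) by apply: FG.
by have [x []] := filter_ex (filterI GA GnA).
Qed.

(** * Herglotz's theorem through discrete Fejer sums and an ultrafilter *)

Section Herglotz.
Context (R : realType) (phi : int -> R) (pd : posdef phi) (phi01 : phi 0 = 1).

Let dirac_comb n : seq (R * int) := [seq (1, Posz m) | m <- index_iota 0 n].

(* Fejer's approximant of order n sampled at the 2n points j / 2n *)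
Definition fejer_weight (n j : nat) : R :=
  (n.*2 * n)%:R^-1 * qform (fun l => phi l * cosn l (j%:R / n.*2%:R)) (dirac_comb n).

Lemma fejer_weight_ge0 n j : 0 <= fejer_weight n j.
Proof. by rewrite mulr_ge0 ?invr_ge0 ?ler0n// (posdef_cosnM _ pd).2. Qed.

Let diag_sum n (k : nat) : (k <= n)%N ->
  \sum_(m < n) \sum_(l < n) phi (m%:Z - l%:Z) * (m%:Z - l%:Z - k%:Z == 0)%:R =
  phi k * (n - k)%:R.
Proof.
move=> kn; rewrite exchange_big /=.
rewrite (eq_bigr (fun l : 'I_n => phi k * (l < n - k)%N%:R)); last first.
  move=> l _; rewrite ltn_subRL; case: ltnP => [kl|kl].
    rewrite (bigD1 (Ordinal kl))//= big1 ?addr0.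
      by rewrite PoszD addrK subrr eqxx.
    move=> m; rewrite -val_eqE /= => mk.
    by rewrite subr_eq0 subr_eq -PoszD eqz_nat (negbTE mk) mulr0.
  rewrite mulr0 big1// => m _.
  rewrite subr_eq0 subr_eq -PoszD eqz_nat.
  by rewrite (ltn_eqF (leq_trans (ltn_ord m) kl)) mulr0.
rewrite -mulr_sumr; congr (_ * _).
rewrite -natr_sum; congr _%:R.
rewrite -big_mkcond /= sum1_card.
have -> : #|[pred i : 'I_n | (i < n - k)%N]| = \sum_(i < n | (i < n - k)%N) 1.
  by rewrite sum1_card.
by rewrite -(@big_ord_widen _ _ _ _ n (fun=> 1%N)) ?leq_subr// sum1_card card_ord.
Qed.

(** The frequencies [m - l - k] and [l - m - k] that occur are at most [2n - 2] in absolute value,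
    so sampling at [2n] points produces no aliasing and the exact Fejer coefficient comes out. *)
Lemma fejer_weight_moment n (k : nat) : (0 < n)%N -> (k <= n.-1)%N ->
  \sum_(j < n.*2) fejer_weight n j * cosn k (j%:R / n.*2%:R) =
  phi k * (n - k)%:R / n%:R.
Proof.
move=> n0 kn; have M0 : (0 < n.*2)%N by rewrite double_gt0.
have kn' : (k <= n)%N by rewrite (leq_trans kn)// leq_pred.
pose x (j : nat) : R := j%:R / n.*2%:R.
pose c : R := (n.*2 * n)%:R^-1.
transitivity (c * \sum_(m < n) \sum_(l < n) phi (m%:Z - l%:Z) *
   \sum_(j < n.*2) cosn (m%:Z - l%:Z) (x j) * cosn k (x j)).
  rewrite (eq_bigr (fun j : 'I_n.*2 => c * \sum_(m < n) \sum_(l < n)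
      phi (m%:Z - l%:Z) * (cosn (m%:Z - l%:Z) (x j) * cosn k (x j)))); last first.
    move=> j _; rewrite /fejer_weight /qform big_map big_mkord -mulrA mulr_suml.
    congr (_ * _); apply: eq_bigr => m _; rewrite big_map big_mkord mulr_suml.
    by apply: eq_bigr => l _; rewrite !mul1r mulrA.
  rewrite -mulr_sumr exchange_big /=; congr (_ * _); apply: eq_bigr => m _.
  by rewrite exchange_big /=; apply: eq_bigr => l _; rewrite mulr_sumr.
have inner (m l : 'I_n) : \sum_(j < n.*2) cosn (m%:Z - l%:Z) (x j) * cosn k (x j) =
    n%:R * ((m%:Z - l%:Z - k%:Z == 0)%:R + (l%:Z - m%:Z - k%:Z == 0)%:R).
  have [lt_m lt_l] := (ltn_ord m, ltn_ord l).
  rewrite (eq_bigr (fun j : 'I_n.*2 => 2^-1 *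
    (cosn (m%:Z - l%:Z - k%:Z) (x j) + cosn (l%:Z - m%:Z - k%:Z) (x j)))); last first.
    move=> j _; rewrite (_ : l%:Z - m%:Z - k%:Z = - (m%:Z - l%:Z + k%:Z)); last by ring.
    by rewrite cosnN (cosnB _ k) (cosnD _ k); field.
  rewrite -mulr_sumr big_split /= !sum_cosn_root//; [|lia|lia].
  by rewrite !natrM -muln2 natrM; field.
under eq_bigr do under eq_bigr do rewrite inner mulrCA mulrDr mulrDr.
have E1 := diag_sum kn'.
have E2 : \sum_(m < n) \sum_(l < n) phi (m%:Z - l%:Z) * (l%:Z - m%:Z - k%:Z == 0)%:R =
    phi k * (n - k)%:R.
  rewrite exchange_big /= -E1; apply: eq_bigr => m _; apply: eq_bigr => l _.
  by rewrite -opprB pd.1.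
under eq_bigr do rewrite big_split -!mulr_sumr /=.
rewrite big_split /= -!mulr_sumr E1 E2 /c -muln2 !natrM.
have ? : n%:R != 0 :> R by rewrite pnatr_eq0 -lt0n.
by field.
Qed.

Definition fejer_sum n (f : R -> R) : R :=
  \sum_(j < n.*2) fejer_weight n j * f (j%:R / n.*2%:R).

Lemma fejer_sum_le n f g : (forall t, 0 <= t < 1 -> f t <= g t) ->
  fejer_sum n f <= fejer_sum n g.
Proof.
move=> fg; apply: ler_sum => j _; rewrite ler_wpM2l ?fejer_weight_ge0// fg//.
have M0 : 0 < n.*2%:R :> R by rewrite ltr0n (leq_ltn_trans _ (ltn_ord j)).
by rewrite divr_ge0//= ltr_pdivrMr// mul1r ltr_nat.
Qed.

Lemma fejer_sum_cst n c : (0 < n)%N -> fejer_sum n (fun=> c) = c.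
Proof.
move=> n0; rewrite /fejer_sum -mulr_suml.
have := @fejer_weight_moment n 0 n0 (leq0n _).
under eq_bigr do rewrite cosn0 mulr1.
by move=> ->; rewrite phi01 subn0 mul1r mulfV ?mul1r// pnatr_eq0 -lt0n.
Qed.

(** Fejer sums are finite sums, defined on every bounded function; their limit along a free
    ultrafilter is therefore a positive functional to which [riesz_circle] applies, in place of weak
    compactness. The moments converge in the ordinary sense, so the ultrafilter does not affect
    them. *)
Lemma herglotz : exists s : probability R R,
  circle_measure s /\ forall n, Ex s (cosn n) = phi n.
Proof.
have [U [UU infU]] := @ultraFilterLemma nat \oo _.
have PU : ProperFilter U by exact: ultra_proper.
pose S f (N : nat) := fejer_sum N.+1 f.
pose L f := lim (S f @ U).
have Lcvg f : bfun f -> S f @ U --> L f.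
  move=> [M fM]; have cpt := @segment_compact R (- M) M.
  rewrite compact_ultra /= in cpt.
  have SM N : (`[- M, M]%classic : set R) (S f N).
    rewrite /= in_itv /= -{1}(@fejer_sum_cst N.+1 (- M))// -{2}(@fejer_sum_cst N.+1 M)//.
    by apply/andP; split; apply: fejer_sum_le => t _; have := fM t;
      rewrite ler_norml => /andP[].
  have [|l [_ cvl]] := cpt _ (ultra_fmap (S f) UU); last first.
    by rewrite /L (cvg_lim _ cvl).
  by apply: (@filterE _ U) => N; exact: SM.
have Lpos : pos_functional L.
  split.
  - move=> f g bf bg; apply/cvg_lim => //.
    have -> : S (fun t => f t + g t) = (fun N => S f N + S g N).
      apply/funext => N; rewrite /S /fejer_sum -big_split /=.
      by apply: eq_bigr => j _; rewrite mulrDr.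
    by apply: cvgD; exact: Lcvg.
  - move=> c f bf; apply/cvg_lim => //.
    have -> : S (fun t => c * f t) = (fun N => c * S f N).
      apply/funext => N; rewrite /S /fejer_sum mulr_sumr.
      by apply: eq_bigr => j _; rewrite mulrCA.
    by apply: cvgMr; exact: Lcvg.
  - move=> f bf f0; apply: (cvgr_to_ge (Lcvg f bf)); apply: (@filterE _ U) => N.
    by rewrite -(@fejer_sum_cst N.+1 0)//; exact: fejer_sum_le.
  - apply/cvg_lim => //; apply: cvg_near_cst; apply: (@filterE _ U) => N.
    by rewrite /S fejer_sum_cst.
have [s [circ sE]] := riesz_circle Lpos; exists s; split=> // n.
rewrite (sE _ `|2 * pi * n%:~R|); [|exact: bmeas_cosn|exact: cosn_lipschitz|]; last first.
  by rewrite cosn1r /cosn mulr0 cos0.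
have posz (k : nat) : L (cosn k) = phi k.
  have cv1 : (N.+1 - k)%:R / N.+1%:R @[N --> \oo] --> (1 - k%:R * 0 : R).
    apply: (@cvg_trans _ ((1 : R) - k%:R * N.+1%:R^-1 @[N --> \oo])).
      apply: near_eq_cvg; near=> N.
      have kN : (k <= N.+1)%N by rewrite leqW//; near: N; exact: nbhs_infty_ge.
      by rewrite natrB// mulrBl mulfV// pnatr_eq0.
    apply: cvgB; first exact: cvg_cst.
    by apply: cvgMr; exact: cvg_harmonic.
  have cvk : phi k * ((N.+1 - k)%:R / N.+1%:R) @[N --> \oo] --> phi k * (1 - k%:R * 0).
    exact: cvgMr cv1.
  rewrite mulr0 subr0 mulr1 in cvk.
  apply/cvg_lim => //; apply: cvg_trans cvk => A /= nA; apply: infU.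
  have [K _ KA] := nA; exists (maxn K k) => // N /= KN.
  rewrite /S /fejer_sum fejer_weight_moment//; last first.
    by rewrite /= (leq_trans (leq_maxr K k)).
  by rewrite -mulrA; apply: KA; exact: leq_trans (leq_maxl K k) KN.
have coseq k : cosn (- k) = cosn k :> (R -> R) by apply/funext => t; rewrite cosnN.
by case: (intP n) => [|k|k]; rewrite ?coseq ?pd.1 posz.
Unshelve. all: by end_near. Qed.

End Herglotz.

(** * From almost invariant vectors to a continuous measure *)

Section Atoms.
Variable R : realType.
Implicit Types (mu : probability R R) (s t : R) (n : int).

(** The mass of a point of the circle: the whole class of [t] modulo 1 counts, whichever
    representatives carry it. *)
Definition atom mu t : R := Ex mu (\1_(cos1set t) : R -> R).

Let bmeas_cos1 t : bmeas (\1_(cos1set t) : R -> R).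
Proof. by apply: bmeas_indic; exact: measurable_cos1set. Qed.

Lemma Ex_avg mu (f : int -> R -> R) N : (forall n, bmeas (f n)) ->
  Ex mu (fun t => avg N (f ^~ t)) = avg N (fun n => Ex mu (f n)).
Proof.
move=> bf; rewrite /avg ExZ; last by apply: bmeas_sum => i; exact: bf.
by rewrite Ex_sum// => i; exact: bf.
Qed.

Lemma bmeas_avg N (f : int -> R -> R) : (forall n, bmeas (f n)) ->
  bmeas (fun t => avg N (f ^~ t)).
Proof. by move=> bf; apply: bmeasZ; apply: bmeas_sum => i; exact: bf. Qed.

Lemma avg_Ex_cvg mu t :
  avg N (fun n => Ex mu (fun s => cosn n (s - t))) @[N --> \oo] --> atom mu t.
Proof.
under eq_fun do rewrite -(Ex_avg _ _ (fun n => bmeas_cosnB n t)).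
apply: (@Ex_cvg _ _ _ mu (fun N s => avgc N (s - t)) _ 1).
- by move=> N; apply: (@bmeas_avg N (fun n s => cosn n (s - t))) => n; exact: bmeas_cosnB.
- by move=> N s; apply: avg_norm_le => // n; exact: normr_cosn.
- by move=> s; exact: avgc_cvg.
Qed.

Lemma avgD N (f g : int -> R) : avg N (fun n => f n + g n) = avg N f + avg N g.
Proof. by rewrite /avg big_split /= mulrDr. Qed.

Lemma avgZ N c (f : int -> R) : avg N (fun n => c * f n) = c * avg N f.
Proof. by rewrite /avg -mulr_sumr mulrCA. Qed.

Lemma ler_avg N (f g : int -> R) : (forall n, f n <= g n) -> avg N f <= avg N g.
Proof. by move=> fg; rewrite ler_wpM2l ?invr_ge0 ?ler0n// ler_sum. Qed.

Lemma eq_avg N (f g : int -> R) : f =1 g -> avg N f = avg N g.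
Proof. by move=> fg; congr (avg N); apply/funext. Qed.

(** Cosine coefficients only see the symmetrised measure, hence the half-sum of the atoms at [t] and
    [- t]. *)
Lemma avg_coef_cos_cvg mu t :
  avg N (fun n => Ex mu (cosn n) * cosn n t) @[N --> \oo] -->
  2^-1 * (atom mu t + atom mu (- t)).
Proof.
have -> : (fun N => avg N (fun n => Ex mu (cosn n) * cosn n t)) = (fun N => 2^-1 *
    (avg N (fun n => Ex mu (fun s => cosn n (s - t))) +
     avg N (fun n => Ex mu (fun s => cosn n (s - - t))))).
  apply/funext => N; rewrite -avgD -avgZ; apply: eq_avg => n.
  rewrite -ExD; [|exact: bmeas_cosnB|exact: bmeas_cosnB].
  rewrite -ExZ; last by apply: bmeasD; exact: bmeas_cosnB.
  rewrite mulrC -ExZ; last exact: bmeas_cosn.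
  by apply: eq_Ex => s; rewrite opprK cosnBr cosnDr; field.
by apply: cvgMr; apply: cvgD; exact: avg_Ex_cvg.
Qed.

Lemma atom_ge0 mu t : 0 <= atom mu t.
Proof. by apply: Ex_ge0 => s; rewrite indicE ler0n. Qed.

Lemma atom_le1 mu t : atom mu t <= 1.
Proof.
rewrite -[leRHS](Ex_cst mu); apply: le_Ex => //; first exact: bmeas_cst.
by move=> s; rewrite indicE lern1 leq_b1.
Qed.

Lemma measure1_le_atom mu t : fine (mu [set t]) <= atom mu t.
Proof.
rewrite -Ex_indic//; apply: le_Ex => //; first exact: bmeas_indic.
move=> s; rewrite !indicE ler_nat; case: (boolP (s \in [set t])) => //.
by rewrite inE => /= ->; rewrite mem_set//= /cos1set /= subrr /cosn mulr0 cos0.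
Qed.

Lemma cosn_cos1set n s t : cos1set t s -> cosn n s = cosn n t.
Proof.
move=> /(cosn1_eq1 n) st; rewrite -[s](subrK t) cosnDr st.
by rewrite (cosn1_sinn st) mul1r mul0r subr0.
Qed.

(** Markov's inequality for [1 - cosn n], which is nonnegative and constant on the class of [t]. *)
Lemma atom_le mu t n : (1 - cosn n t) * atom mu t <= 1 - Ex mu (cosn n).
Proof.
have -> : 1 - Ex mu (cosn n) = Ex mu (fun s => 1 - cosn n s).
  by rewrite ExB ?Ex_cst//; [exact: bmeas_cst|exact: bmeas_cosn].
rewrite /atom -ExZ//.
apply: le_Ex; first exact: bmeasZ.
  by apply: bmeasB; [exact: bmeas_cst|exact: bmeas_cosn].
move=> s; rewrite indicE; case: (boolP (s \in cos1set t)) => [|_] /=.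
  by rewrite inE mulr1 => /(cosn_cos1set n) ->.
by rewrite mulr0 subr_ge0 cosn_le1.
Qed.

Lemma atom_cos1 mu t : cosn 1 t = 1 -> atom mu t = atom mu 0.
Proof.
move=> t1; rewrite /atom; congr (Ex mu \1_ _); apply/funext => s.
by rewrite /cos1set /= subr0 cosnBr t1 (cosn1_sinn t1) mulr1 mulr0 addr0.
Qed.

(** The [n] with [cosn n t = 1] form a subgroup; were it to contain [Q], it would contain 1. *)
Lemma generates_cosn (Q : set int) t : generates_Z Q -> cosn 1 t != 1 ->
  exists2 n, Q n & cosn n t != 1.
Proof.
move=> gQ; apply: contra_neqP => noQ.
elim: (gQ 1) => [q Qq||a b _ IHa _ IHb|a _ IHa].
- by apply/eqP/negPn/negP => c1; apply: noQ; exists q.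
- exact: cosn0.
- exact: cosn1D.
- by rewrite cosnN.
Qed.

End Atoms.

(** * A decreasing product of positive definite functions with vanishing mean *)

Section ContinuousMeasure.
Context (R : realType) (Q : set int) (gQ : generates_Z Q).
Context (almost1 : forall e : R, 0 < e -> exists mu : probability R R,
  atom mu 0 = 0 /\ forall n, Q n -> 1 - e <= Ex mu (cosn n)).

(** For measures [mu j] with error [e / (j + 1)] on [Q], the mean is the integral of [b j] against
    [s]. At the class of 0, [b j] is 0 by hypothesis; elsewhere some [n] in [Q] has [cosn n t != 1],
    and [atom_le] bounds [b j t] by [e / (j + 1)] over [1 - cosn n t]. This is not uniform in [t],
    so the index [j] depends on [s]. *)
Lemma mean_product_small (s : probability R R) (e r : R) : 0 < e -> 0 < r ->
  exists mu : probability R R, (forall n, Q n -> 1 - e <= Ex mu (cosn n)) /\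
    \forall N \near \oo, avg N (fun n => Ex s (cosn n) * Ex mu (cosn n)) <= r.
Proof.
move=> e0 r0.
have ej (j : nat) : 0 < e * j.+1%:R^-1 by rewrite mulr_gt0// invr_gt0 ltr0n.
have [mu muP] := choice (fun j => almost1 (ej j)).
pose b j t := 2^-1 * (atom (mu j) t + atom (mu j) (- t)).
have bm j n : bmeas (fun t : R => Ex (mu j) (cosn n) * cosn n t).
  by apply: bmeasZ; exact: bmeas_cosn.
have bb j N t : `|avg N (fun n => Ex (mu j) (cosn n) * cosn n t)| <= 1.
  apply: avg_norm_le => // n; rewrite normrM -[leRHS]mulr1 ler_pM// ?normr_cosn//.
  by apply: Ex_norm_le; [exact: bmeas_cosn|exact: normr_cosn].
have b_meas j : bmeas (b j).
  apply: (bmeas_lim (fun N => bmeas_avg N (bm j)) (bb j)) => t.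
  exact: avg_coef_cos_cvg.
have b_ge0 j t : 0 <= b j t by rewrite mulr_ge0 ?invr_ge0 ?addr_ge0 ?atom_ge0.
have cvgN j : avg N (fun n => Ex s (cosn n) * Ex (mu j) (cosn n)) @[N --> \oo] --> Ex s (b j).
  have -> : (fun N => avg N (fun n => Ex s (cosn n) * Ex (mu j) (cosn n))) =
      (fun N => Ex s (fun t => avg N (fun n => Ex (mu j) (cosn n) * cosn n t))).
    apply/funext => N; rewrite (Ex_avg _ _ (bm j)); apply: eq_avg => n.
    by rewrite mulrC ExZ//; exact: bmeas_cosn.
  apply: (@Ex_cvg _ _ _ s (fun N t => avg N (fun n => Ex (mu j) (cosn n) * cosn n t))
    (b j) 1) => [N|N t|t]; [exact: bmeas_avg|exact: bb|exact: avg_coef_cos_cvg].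
have cvgj : Ex s (b j) @[j --> \oo] --> Ex s (fun=> 0).
  apply: (@Ex_cvg _ _ _ s b _ 1) => //.
    move=> j t; rewrite ger0_norm//.
    by have := atom_le1 (mu j) t; have := atom_le1 (mu j) (- t); rewrite /b; lra.
  move=> t; have [t1|t1] := eqVneq (cosn 1 t) 1.
    apply: cvg_near_cst; near=> j; rewrite /b !atom_cos1 ?cosnNr//.
    by rewrite (muP j).1 addr0 mulr0.
  have [n Qn n1] := generates_cosn gQ t1.
  have d0 : 0 < 1 - cosn n t by rewrite subr_gt0 lt_neqAle n1 cosn_le1.
  have cv0 : (1 - cosn n t)^-1 * (e * j.+1%:R^-1) @[j --> \oo] -->
      ((1 - cosn n t)^-1 * (e * 0) : R).
    by do 2!apply: cvgMr; exact: cvg_harmonic.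
  rewrite !mulr0 in cv0.
  apply: squeeze_cvgr (cvg_cst 0) cv0; near=> j; rewrite b_ge0 /= ler_pdivlMl//.
  have := (muP j).2 n Qn; have := atom_le (mu j) t n; have := atom_le (mu j) (- t) n.
  rewrite cosnNr => h1 h2 h3; rewrite /b mulrCA [in leLHS]mulrDr.
  by move: h1 h2 h3; move: (_ * atom _ _) (_ * atom _ _) (e * _) => x y z; lra.
rewrite Ex_cst in cvgj.
have /cvgr_lt/(_ _ r0)[j _ /(_ j (leqnn j)) bj] := cvgj.
exists (mu j); split.
  move=> n /(muP j).2; apply: le_trans; rewrite lerB// ler_piMr ?(ltW e0)//.
  by rewrite invf_le1 ?ltr0n// ler1n.
near=> N; apply: ltW; near: N.
by have /cvgr_lt/(_ _ bj) := cvgN j.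
Unshelve. all: by end_near. Qed.

(** The last clause says that the mean is at most [a] without asking that it exist as a limit. *)
Definition good_coef (P : int -> R) (a : R) :=
  [/\ posdef P, P 0 = 1, (forall n, 0 <= P n <= 1) & \forall N \near \oo, avg N P <= a].

Lemma good_coef_step P a e : 0 < a -> 0 < e -> good_coef P a ->
  exists P', [/\ good_coef P' (3 / 4 * a), forall n, P' n <= P n &
    forall n, Q n -> P n - e <= P' n].
Proof.
move=> a0 e0 [pd P01 Pb avgP].
have [s [_ sP]] := herglotz pd P01.
have [mu [muQ avgmu]] := mean_product_small s e0 (divr_gt0 a0 (ltr0n R 2)).
pose psi n := Ex mu (cosn n).
have psi_b n : -1 <= psi n <= 1.
  by rewrite -ler_norml; apply: Ex_norm_le; [exact: bmeas_cosn|exact: normr_cosn].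
exists (fun n => 2^-1 * (P n + P n * psi n)); split; last 2 first.
- move=> n; have /andP[p0 p1] := Pb n; have /andP[_ q1] := psi_b n.
  have : P n * psi n <= P n * 1 by rewrite ler_wpM2l.
  lra.
- move=> n /muQ; rewrite -/(psi n) => q1; have /andP[p0 p1] := Pb n.
  have : P n * (1 - e) <= P n * psi n by rewrite ler_wpM2l.
  have : P n * e <= 1 * e by rewrite ler_wpM2r// ltW.
  lra.
split.
- apply: posdefZ; first by rewrite invr_ge0.
  by apply: posdefD => //; exact: posdef_ExM.
- rewrite P01 /psi (_ : Ex mu _ = 1); first by field.
  by rewrite -[RHS](Ex_cst mu); apply: eq_Ex => t; rewrite cosn0.
- move=> n; have /andP[p0 p1] := Pb n; have /andP[q0 q1] := psi_b n.
  have : P n * -1 <= P n * psi n by rewrite ler_wpM2l.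
  have : P n * psi n <= P n * 1 by rewrite ler_wpM2l.
  by move=> ? ?; apply/andP; split; lra.
- near=> N; rewrite avgZ avgD.
  have : avg N P <= a by near: N.
  have : avg N (fun n => P n * psi n) <= a / 2.
    under eq_avg do rewrite -sP.
    by near: N.
  lra.
Unshelve. all: by end_near. Qed.

(** Step [k] may lose [eta / 2^(k+1)] on [Q]; the losses add up to less than [eta]. *)
Lemma good_coef_sequence (eta : R) : 0 < eta -> exists P : nat -> int -> R,
  [/\ forall k, good_coef (P k) ((3 / 4) ^+ k), forall k n, P k.+1 n <= P k n &
      forall k n, Q n -> 1 - eta <= P k n].
Proof.
move=> eta0.
have a0 k : 0 < (3 / 4 : R) ^+ k by rewrite exprn_gt0//; lra.
have e0 k : 0 < eta * 2^-1 ^+ k.+1 by rewrite mulr_gt0// exprn_gt0// invr_gt0.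
(* Goodness sits under the existential so that [choice] yields a total function on pairs (index,
   current product); a pair that is not good gets an arbitrary value. *)
have step (x : nat * (int -> R)) : exists P', good_coef x.2 ((3 / 4) ^+ x.1) ->
    [/\ good_coef P' ((3 / 4) ^+ x.1.+1), forall n, P' n <= x.2 n &
    forall n, Q n -> x.2 n - eta * 2^-1 ^+ x.1.+1 <= P' n].
  case: (pselect (good_coef x.2 ((3 / 4) ^+ x.1))) => [g|ng]; last by exists x.2.
  by have [P' P'P] := good_coef_step (a0 x.1) (e0 x.1) g; exists P' => _; rewrite exprS.
have [F FP] := choice step.
pose P := fix P k := if k is k'.+1 then F (k', P k') else fun=> 1.
have Pgood k : good_coef (P k) ((3 / 4) ^+ k).
  elim: k => [|k IH]; last by have [] := FP (k, P k) IH.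
  split=> //=; first exact: posdef1.
    by move=> n; rewrite ler01 lexx.
  near=> N; rewrite expr0 /avg sumr_const card_ord mulVf// pnatr_eq0 -lt0n.
  by near: N; exact: nbhs_infty_gt.
exists P; split=> //; first by move=> k; have [] := FP (k, P k) (Pgood k).
move=> k n Qn; have : 1 - eta * (1 - 2^-1 ^+ k) <= P k n.
  elim: k => [|k IH]; first by rewrite expr0 subrr mulr0 subr0.
  have [_ _ /(_ n Qn)] := FP (k, P k) (Pgood k).
  by rewrite /= exprS; lra.
apply: le_trans; rewrite lerB// ler_piMr ?(ltW eta0)//.
by rewrite lerBlDl lerDr exprn_ge0// invr_ge0.
Unshelve. all: by end_near. Qed.

(** As [0 <= Pi <= P k], the means of [Pi n * cosn n t] are at most those of [P k], hence eventually
    at most [(3 / 4) ^+ k], for every [t] and [k]: all atoms vanish. On [Q] the real part of the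
    coefficient is at least [1 - eta = (1 + delta) / 2], midway between [delta] and 1. *)
Lemma almost1_delta_Ka_plus (delta : R) : delta < 1 -> delta_Ka_plus delta Q.
Proof.
move=> d1; have eta0 : 0 < (1 - delta) / 2 by lra.
have [P [Pgood Pdec PQ]] := good_coef_sequence eta0.
have P_ge0 k n : 0 <= P k n by have [_ _ /(_ n)/andP[]] := Pgood k.
have ni n : nonincreasing_seq (P ^~ n).
  by apply/nonincreasing_seqP => k; exact: Pdec.
have cvP n : P ^~ n @ \oo --> limn (P ^~ n).
  apply: nonincreasing_is_cvgn => //.
  by exists 0 => _ [k _ <-].
pose Pi n := limn (P ^~ n).
have PiP k n : Pi n <= P k n.
  by apply: nonincreasing_cvgn_ge => //; exact: cvP.
have pd : posdef Pi by apply: (posdef_lim _ cvP) => k; have [] := Pgood k.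
have Pi0 : Pi 0 = 1.
  apply/cvg_lim => //; apply: cvg_near_cst; near=> k.
  by have [] := Pgood k.
have Pi_ge0 n : 0 <= Pi n.
  by apply: (cvgr_to_ge (cvP n)); near=> k; exact: P_ge0.
have [s [circ sP]] := herglotz pd Pi0.
exists s; split=> //; split.
  move=> t.
  have at0 k : atom s t <= 2 * (3 / 4) ^+ k.
    suff : 2^-1 * (atom s t + atom s (- t)) <= (3 / 4) ^+ k.
      by have := atom_ge0 s (- t); lra.
    apply: (cvgr_to_le (@avg_coef_cos_cvg _ s t)); near=> N.
    apply: (@le_trans _ _ (avg N (P k))); last first.
      by near: N; have [] := Pgood k.
    apply: ler_avg => n; rewrite sP (le_trans _ (PiP k n))//.
    by rewrite ler_piMr// cosn_le1.
  have cv0 : 2 * (3 / 4) ^+ k @[k --> \oo] --> (2 * 0 : R).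
    by apply: cvgMr; apply: cvg_expr; rewrite ger0_norm; lra.
  rewrite mulr0 in cv0.
  have : atom s t <= 0 by apply: (cvgr_to_ge cv0); near=> k.
  move=> /(le_trans (measure1_le_atom s t)) fs.
  have s_fin : s [set t] \is a fin_num by exact: fin_num_measure.
  apply/eqP; rewrite eq_le measure_ge0 andbT -(fineK s_fin) lee_fin//.
exists ((1 + delta) / 2); split; first lra.
move=> n Qn; apply: (@le_trans _ _ (Pi n)).
  apply: (cvgr_to_ge (cvP n)); near=> k; have := PQ k n Qn; lra.
rewrite -sP /modC /=; set x := Ex s _; rewrite (le_trans (ler_norm _))// -sqrtr_sqr.
by rewrite ler_wsqrtr// lerDl sqr_ge0.
Unshelve. all: by end_near. Qed.

End ContinuousMeasure.

(** * The mean ergodic theorem for Dirichlet kernels in L2 of a measure *)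

Section TrigForm.
Variable R : realType.
Implicit Types (v w : seq (R * int)) (t : R).

Definition evl (f : int -> R) v : R := \sum_(p <- v) p.1 * f p.2.

(** Both sides are the squared modulus of the trigonometric polynomial with coefficients [v] at
    [t]. *)
Lemma qform_cosn v t :
  qform (cosn ^~ t) v = evl (cosn ^~ t) v ^+ 2 + evl (sinn ^~ t) v ^+ 2.
Proof.
rewrite /qform /evl !expr2 !mulr_suml -big_split /=; apply: eq_bigr => p _.
rewrite !mulr_sumr -big_split /=; apply: eq_bigr => q _.
by rewrite cosnB; ring.
Qed.

Lemma bmeas_qform_cosn v : bmeas (fun t => qform (cosn ^~ t) v).
Proof.
by do 2!apply: bmeas_sum => ?; apply: bmeasZ; exact: bmeas_cosn.
Qed.

Lemma qform_Ex (mu : probability R R) v :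
  qform (fun n => Ex mu (cosn n)) v = Ex mu (fun t => qform (cosn ^~ t) v).
Proof.
have bm (a : R) n : bmeas (fun t => a * cosn n t) by apply: bmeasZ; exact: bmeas_cosn.
rewrite Ex_sum; last by move=> p; apply: bmeas_sum => q; exact: bm.
apply: eq_bigr => p _; rewrite Ex_sum => [|q]; last exact: bm.
by apply: eq_bigr => q _; rewrite ExZ//; exact: bmeas_cosn.
Qed.

Definition scalev (a : R) v : seq (R * int) := [seq (a * p.1, p.2) | p <- v].
Definition shiftv k v : seq (R * int) := [seq (p.1, p.2 + k) | p <- v].
Definition avgv N : seq (R * int) := [seq (N%:R^-1, Posz n) | n <- index_iota 0 N].

Lemma evl_cat f v w : evl f (v ++ w) = evl f v + evl f w.
Proof. exact: big_cat. Qed.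

Lemma evl_scale f a v : evl f (scalev a v) = a * evl f v.
Proof.
by rewrite /evl big_map mulr_sumr; apply: eq_bigr => p _; rewrite mulrA.
Qed.

Lemma evl_shift f k v : evl f (shiftv k v) = evl (fun n => f (n + k)) v.
Proof. by rewrite /evl big_map. Qed.

Lemma evl_avgv f N : evl f (avgv N) = avg N f.
Proof. by rewrite /evl big_map big_mkord /avg mulr_sumr. Qed.

Lemma evlD f g v : evl (fun n => f n + g n) v = evl f v + evl g v.
Proof. by rewrite /evl -big_split; apply: eq_bigr => p _; rewrite mulrDr. Qed.

Lemma evlZ c f v : evl (fun n => c * f n) v = c * evl f v.
Proof. by rewrite /evl mulr_sumr; apply: eq_bigr => p _; rewrite mulrCA. Qed.

Let cN N t := avgc N t.
Let sN N t := avgs N t.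
Let Z t : R := \1_(cos1set (0 : R)) t.

Let cN_cvg t : cN N t @[N --> \oo] --> Z t.
Proof. by have := @avgc_cvg R 0 t; rewrite subr0. Qed.

Let cN_le N t : `|cN N t| <= 1.
Proof. by apply: avg_norm_le => // n; exact: normr_cosn. Qed.

Let sN_le N t : `|sN N t| <= 1.
Proof. by apply: avg_norm_le => // n; exact: normr_sinn. Qed.

Let bmeas_cN N : bmeas (cN N).
Proof. by apply: (@bmeas_avg _ N (@cosn R)); exact: bmeas_cosn. Qed.

Let bmeas_sN N : bmeas (sN N).
Proof. by apply: (@bmeas_avg _ N (@sinn R)); exact: bmeas_sinn. Qed.

Let bmeas_Z : bmeas Z.
Proof. by apply: bmeas_indic; exact: measurable_cos1set. Qed.

Let sqr_le1 (x : R) : `|x| <= 1 -> x ^+ 2 <= 1.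
Proof. by move=> x1; rewrite -real_normK ?num_real// expr_le1. Qed.

Let Zsq t : Z t ^+ 2 = Z t.
Proof. by rewrite /Z indicE; case: (_ \in _); rewrite ?expr1n// expr0n. Qed.

(** The integrand is the squared modulus of the Dirichlet kernel; it is bounded and tends to the
    indicator of the class of 0. *)
Lemma qform_avgv_cvg (mu : probability R R) :
  qform (fun n => Ex mu (cosn n)) (avgv N) @[N --> \oo] --> atom mu 0.
Proof.
under eq_fun do rewrite qform_Ex.
apply: (@Ex_cvg _ _ _ mu (fun N t => qform (cosn ^~ t) (avgv N)) _ 2).
- by move=> N; exact: bmeas_qform_cosn.
- move=> N t; rewrite qform_cosn !evl_avgv ger0_norm ?addr_ge0 ?sqr_ge0//.
  by rewrite -[2]/(1 + 1) lerD// sqr_le1//; [exact: cN_le|exact: sN_le].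
- move=> t; under eq_fun do rewrite qform_cosn !evl_avgv !expr2.
  have cv : cN N t * cN N t + sN N t * sN N t @[N --> \oo] --> Z t * Z t + 0 * 0.
    by apply: cvgD; apply: cvgM; [exact: cN_cvg|exact: cN_cvg|exact: avgs_cvg|exact: avgs_cvg].
  by rewrite mulr0 addr0 -expr2 Zsq in cv.
Qed.

Lemma qform_avgv_cauchy (mu : probability R R) e : 0 < e ->
  exists K : nat, forall N M, (K <= N)%N -> (K <= M)%N ->
  qform (fun n => Ex mu (cosn n)) (avgv N ++ scalev (-1) (avgv M)) < e.
Proof.
move=> e0; pose g N t := (cN N t - Z t) ^+ 2 + sN N t ^+ 2.
have bg N : bmeas (g N).
  by apply: bmeasD; rewrite /g; under eq_fun do rewrite expr2; apply: bmeasM => //;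
    exact: bmeasB.
have gcv : Ex mu (g N) @[N --> \oo] --> Ex mu (fun=> 0).
  apply: (@Ex_cvg _ _ _ mu g _ 5) => //.
    move=> N t; rewrite ger0_norm ?addr_ge0 ?sqr_ge0//.
    rewrite (_ : 5 = 4 + 1 :> R); last by lra.
    rewrite lerD ?sqr_le1// -real_normK ?num_real//.
    have : `|cN N t - Z t| <= 2.
      rewrite (le_trans (ler_normB _ _))// -[2]/(1 + 1) lerD//.
      by rewrite /Z indicE; case: (_ \in _); rewrite ?normr1 ?normr0.
    by move=> h; have := normr_ge0 (cN N t - Z t); nra.
  move=> t; rewrite /g; under eq_fun do rewrite !expr2.
  have cv : (cN N t - Z t) * (cN N t - Z t) + sN N t * sN N t @[N --> \oo] -->
      (Z t - Z t) * (Z t - Z t) + 0 * 0.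
    by apply: cvgD; apply: cvgM; try exact: avgs_cvg;
      apply: cvgB; try exact: cvg_cst; exact: cN_cvg.
  by rewrite subrr mulr0 addr0 in cv.
rewrite Ex_cst in gcv.
have e4 : 0 < e / 4 by lra.
have /cvgr_lt/(_ _ e4)[K _ KP] := gcv; exists K => N M KN KM.
rewrite qform_Ex.
apply: (@le_lt_trans _ _ (Ex mu (fun t => 2 * (g N t + g M t)))).
  apply: le_Ex; first exact: bmeas_qform_cosn.
    by apply: bmeasZ; exact: bmeasD.
  move=> t; rewrite qform_cosn !evl_cat !evl_scale !evl_avgv.
  rewrite -subr_ge0; set lhs := (X in 0 <= X).
  (* Parallelogram identity for the two kernels centred at their common limit [Z]. *)
  have -> : lhs = (cN N t + cN M t - 2 * Z t) ^+ 2 + (sN N t + sN M t) ^+ 2.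
    by rewrite /lhs /g /cN /sN /avgc /avgs; ring.
  by rewrite addr_ge0 ?sqr_ge0.
rewrite ExZ; last exact: bmeasD.
by rewrite ExD//; have := KP _ KN; have := KP _ KM => /= ? ?; lra.
Qed.

(** Shifting multiplies the kernel by a character, so the integrand is the squared kernel times
    [|exp (2 i pi k t) - 1|^2]; the kernel concentrates on the class of 0, where this factor is
    0. *)
Lemma qform_shift_avgv_cvg (mu : probability R R) k :
  qform (fun n => Ex mu (cosn n)) (shiftv k (avgv N) ++ scalev (-1) (avgv N))
    @[N --> \oo] --> (0 : R).
Proof.
have E N t : qform (cosn ^~ t) (shiftv k (avgv N) ++ scalev (-1) (avgv N)) =
    (cN N t ^+ 2 + sN N t ^+ 2) * (2 - 2 * cosn k t).
  rewrite qform_cosn !evl_cat !evl_scale !evl_shift.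
  have -> : evl (fun n => cosn (n + k) t) (avgv N) = cosn k t * cN N t - sinn k t * sN N t.
    rewrite /cN /sN /avgc /avgs -!evl_avgv -mulNr -!evlZ -evlD; congr evl; apply/funext => n.
    by rewrite cosnD; ring.
  have -> : evl (fun n => sinn (n + k) t) (avgv N) = cosn k t * sN N t + sinn k t * cN N t.
    rewrite /cN /sN /avgc /avgs -!evl_avgv -!evlZ -evlD; congr evl; apply/funext => n.
    by rewrite sinnD; ring.
  rewrite !evl_avgv /cN /sN /avgc /avgs.
  transitivity ((avg N (cosn ^~ t) ^+ 2 + avg N (sinn ^~ t) ^+ 2) * (cosn k t ^+ 2 + sinn k t ^+ 2 + 1 - 2 * cosn k t)).
    by ring.
  by rewrite sinn2cosn2; ring.
rewrite -(Ex_cst mu 0).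
under eq_fun do rewrite qform_Ex.
apply: (@Ex_cvg _ _ _ mu (fun N t => qform (cosn ^~ t)
   (shiftv k (avgv N) ++ scalev (-1) (avgv N))) _ 8).
- by move=> N; exact: bmeas_qform_cosn.
- move=> N t; rewrite E normrM (_ : 8 = 2 * 4 :> R); last by lra.
  apply: ler_pM => //.
    rewrite ger0_norm ?addr_ge0 ?sqr_ge0// -[2]/(1 + 1) lerD// sqr_le1//.
  by have := normr_cosn k t; rewrite !ler_norml => /andP[? ?]; apply/andP; split; lra.
- move=> t; under eq_fun do rewrite E.
  have -> : 0 = (Z t * Z t + 0 * 0) * (2 - 2 * cosn k t).
    rewrite /Z indicE; case: (boolP (t \in _)) => [|_] /=; last by ring.
    by rewrite inE /cos1set /= subr0 => /(cosn1_eq1 k) ->; ring.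
  apply: cvgMl; under eq_fun do rewrite !expr2.
  by apply: cvgD; apply: cvgM; [exact: cN_cvg|exact: cN_cvg|exact: avgs_cvg|exact: avgs_cvg].
Qed.

End TrigForm.

(** * Spectral measures of vectors of a unitary representation *)

Section UnitaryRep.
Context (R : realType) (V : lmodType R[i]) (ip : V -> V -> R[i]) (pi : int -> V -> V).
Context (Hip : is_inner_product ip) (Hpi : unitary_rep ip pi).

(** The underlying real inner product has the same norm, and its matrix coefficients are real and
    even, as cosine coefficients must be. *)
Let B (x y : V) : R := complex.Re (ip x y).

Let ipD x y z : ip (x + y) z = ip x z + ip y z.
Proof. by case: Hip => L _ _ _; have := L 1 x y z; rewrite scale1r mul1r. Qed.

Let ip0 z : ip 0 z = 0.
Proof. by apply: (addrI (ip 0 z)); rewrite -ipD !addr0. Qed.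

Let ipZ a x z : ip (a *: x) z = a * ip x z.
Proof. by case: Hip => L _ _ _; have := L a x 0 z; rewrite addr0 ip0 addr0. Qed.

Let BC x y : B x y = B y x.
Proof. by case: Hip => _ C _ _; rewrite /B (C y x); case: (ip y x). Qed.

Let BDl x y z : B (x + y) z = B x z + B y z.
Proof. by rewrite /B ipD; case: (ip x z) (ip y z) => [? ?] [? ?]. Qed.

Let BZl (a : R) x z : B (a%:C%C *: x) z = a * B x z.
Proof. by rewrite /B ipZ; case: (ip x z) => b c /=; rewrite mul0r subr0. Qed.

Let B0l z : B 0 z = 0.
Proof. by rewrite /B ip0. Qed.

Let Bsum (I : Type) (r : seq I) (F : I -> V) z :
  B (\sum_(i <- r) F i) z = \sum_(i <- r) B (F i) z.
Proof. by elim: r => [|i r IH]; rewrite ?big_nil ?B0l// !big_cons BDl IH. Qed.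

Let nsq x := B x x.

Let nsq_ge0 x : 0 <= nsq x.
Proof. by case: Hip => _ _ /(_ x)[_ +] _. Qed.

Let nsq_eq0 x : nsq x = 0 -> x = 0.
Proof.
case: Hip => _ _ /(_ x)[im0 _] D n0; apply: D; rewrite /nsq /B in n0.
by case: (ip x x) im0 n0 => a b /= -> ->.
Qed.

Let CN1 : (-1)%:C%C = -1 :> R[i].
Proof. by apply/eqP; rewrite eq_complex /= oppr0 !eqxx. Qed.

Let CM (a b : R) : (a * b)%:C%C = a%:C%C * b%:C%C :> R[i].
Proof. by apply/eqP; rewrite eq_complex /= !mulr0 mul0r subr0 addr0 !eqxx. Qed.

Let nsqN x : nsq (- x) = nsq x.
Proof.
have NE (y : V) : - y = (-1)%:C%C *: y by rewrite CN1 scaleN1r.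
by rewrite /nsq NE BZl BC BZl mulrA mulrNN !mul1r.
Qed.

Let nsqD x y : nsq (x + y) = nsq x + nsq y + 2 * B x y.
Proof. by rewrite /nsq BDl BC BDl [B _ (x + y)]BC BDl (BC y x); ring. Qed.

Let nsqD_le x y : nsq (x + y) <= 2 * nsq x + 2 * nsq y.
Proof.
have := nsq_ge0 (x - y); rewrite !nsqD nsqN.
have -> : B x (- y) = - B x y.
  have -> : - y = (-1)%:C%C *: y by rewrite CN1 scaleN1r.
  by rewrite BC BZl BC mulN1r.
lra.
Qed.

Let hnormE x : hnorm ip x = Num.sqrt (nsq x). Proof. by []. Qed.

Let hnorm_sqr x : hnorm ip x ^+ 2 = nsq x.
Proof. by rewrite hnormE sqr_sqrtr. Qed.

Let hnorm_lt x e : 0 < e -> (hnorm ip x < e) = (nsq x < e ^+ 2).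
Proof. by move=> e0; rewrite -hnorm_sqr ltr_sqr ?nnegrE ?sqrtr_ge0 ?ltW. Qed.

Let pi0 n : pi n 0 = 0.
Proof.
case: Hpi => _ _ L _; have := L n 1 0 0; rewrite !scale1r !addr0.
by move=> E; apply: (addrI (pi n 0)); rewrite addr0 -E.
Qed.

Let piD n x y : pi n (x + y) = pi n x + pi n y.
Proof. by case: Hpi => _ _ L _; have := L n 1 x y; rewrite !scale1r. Qed.

Let piZ n a x : pi n (a *: x) = a *: pi n x.
Proof. by case: Hpi => _ _ L _; have := L n a x 0; rewrite !addr0 pi0 addr0. Qed.

Let pi_sum n (I : Type) (r : seq I) (F : I -> V) :
  pi n (\sum_(i <- r) F i) = \sum_(i <- r) pi n (F i).
Proof. by elim: r => [|i r IH]; rewrite ?big_nil ?pi0// !big_cons piD IH. Qed.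

Let piN n x : pi n (- x) = - pi n x.
Proof. by apply: (addrI (pi n x)); rewrite -piD !subrr pi0. Qed.

Let nsq_pi n x : nsq (pi n x) = nsq x.
Proof. by case: Hpi => _ _ _ U; rewrite /nsq /B U. Qed.

Variable x : V.
Let phi n := B (pi n x) x.

Let B_pi m n : B (pi m x) (pi n x) = phi (m - n).
Proof.
case: Hpi => _ A _ U.
by rewrite -[in LHS](subrK n m) addrC A /B U.
Qed.

Let phiN n : phi (- n) = phi n.
Proof.
by case: Hpi => Z0 _ _ _; rewrite -sub0r -B_pi Z0 BC.
Qed.

Let vec (v : seq (R * int)) : V := \sum_(p <- v) p.1%:C%C *: pi p.2 x.

Let nsq_vec v : nsq (vec v) = qform phi v.
Proof.
rewrite /nsq {1}/vec Bsum; apply: eq_bigr => p _.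
rewrite BZl BC Bsum mulr_sumr; apply: eq_bigr => q _.
by rewrite BZl BC B_pi mulrA.
Qed.

Let vec_cat v w : vec (v ++ w) = vec v + vec w.
Proof. exact: big_cat. Qed.

Let vec_scale a v : vec (scalev a v) = a%:C%C *: vec v.
Proof.
rewrite /vec big_map scaler_sumr; apply: eq_bigr => p _.
by rewrite CM scalerA.
Qed.

Let vec_shift k v : vec (shiftv k v) = pi k (vec v).
Proof.
case: Hpi => _ A _ _.
rewrite /vec big_map pi_sum; apply: eq_bigr => p _.
by rewrite piZ addrC A.
Qed.

Let vecN v : vec (scalev (-1) v) = - vec v.
Proof. by rewrite vec_scale CN1 scaleN1r. Qed.

Context (complete : is_complete ip) (x0 : hnorm ip x != 0).
Context (noinv : forall y, (forall n, pi n y = y) -> y = 0).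

Let n0 : 0 < nsq x.
Proof. by rewrite lt_neqAle nsq_ge0 andbT eq_sym -hnorm_sqr sqrf_eq0. Qed.

(* The averages of the orbit of x converge to an invariant vector, hence to 0;
   their squared norms converge to the mass of the spectral measure at 1. *)
Lemma spectral_measure : exists mu : probability R R, atom mu 0 = 0 /\
  forall n, hnorm ip (pi n x - x) ^+ 2 = 2 * hnorm ip x ^+ 2 * (1 - Ex mu (cosn n)).
Proof.
have phi0 : phi 0 = nsq x by case: Hpi => Z0 _ _ _; rewrite /phi Z0.
have pd : posdef (fun n => (nsq x)^-1 * phi n).
  apply: posdefZ; first by rewrite invr_ge0.
  by split=> // v; rewrite -nsq_vec.
have [|mu [_ muP]] := herglotz pd; first by rewrite phi0 mulVf// gt_eqF.
have phiE n : phi n = nsq x * Ex mu (cosn n).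
  by rewrite muP mulrA mulfV ?mul1r// gt_eqF.
have qE v : nsq (vec v) = nsq x * qform (fun n => Ex mu (cosn n)) v.
  rewrite nsq_vec /qform mulr_sumr; apply: eq_bigr => p _.
  by rewrite mulr_sumr; apply: eq_bigr => q _; rewrite phiE mulrCA.
exists mu; split; last first.
  move=> n; rewrite !hnorm_sqr nsqD nsqN nsq_pi.
  have -> : B (pi n x) (- x) = - phi n.
    have -> : - x = (-1)%:C%C *: x by rewrite CN1 scaleN1r.
    by rewrite BC BZl BC mulN1r.
  by rewrite phiE; ring.
pose A N := vec (avgv R N).
have [l lP] : exists l, forall e, 0 < e -> exists N, forall n, (N <= n)%N ->
    hnorm ip (A n - l) < e.
  apply: complete => e e0.
  have e0' : 0 < e ^+ 2 / nsq x by rewrite divr_gt0// exprn_gt0.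
  have [K KP] := qform_avgv_cauchy mu e0'; exists K => m n Km Kn.
  rewrite hnorm_lt// /A -vecN -vec_cat qE mulrC -ltr_pdivlMr//.
  exact: KP.
have AlP e : 0 < e -> \forall N \near \oo, nsq (A N - l) < e.
  move=> e0; have [K KP] : exists K, forall n, (K <= n)%N -> hnorm ip (A n - l) < Num.sqrt e.
    by apply: lP; rewrite sqrtr_gt0.
  exists K => // n /KP; rewrite hnorm_lt ?sqrtr_gt0// sqr_sqrtr// ltW//.
have linv k : pi k l = l.
  apply/eqP; rewrite -subr_eq0; apply/eqP/nsq_eq0; apply/eqP.
  rewrite eq_le nsq_ge0 andbT; apply/ler_addgt0Pr => e e0; rewrite add0r.
  (* Two uses of [nsqD_le] give the three pieces the coefficients 2, 4 and 4, for a total below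
     [10 * e / 12]. *)
  have e12 : 0 < e / 12 by lra.
  have e12' : 0 < e / 12 / nsq x by rewrite divr_gt0.
  have /cvgr_lt/(_ _ e12')[K2 _ K2P] := qform_shift_avgv_cvg mu k.
  have [K1 _ K1P] := AlP _ e12.
  pose N := maxn K1 K2.
  have h1 : nsq (A N - l) < e / 12 by apply: K1P; exact: leq_maxl.
  have h2 : nsq (pi k (A N) - A N) < e / 12.
    rewrite /A -vecN -vec_shift -vec_cat qE mulrC -ltr_pdivlMr//.
    by apply: K2P; exact: leq_maxr.
  have -> : pi k l - l = pi k (- (A N - l)) + ((pi k (A N) - A N) + (A N - l)).
    have tel (a b c d : V) : (a - b) + ((b - c) + (c - d)) = a - d.
      by rewrite [b - c + _]addrA subrK addrA subrK.
    by rewrite piN piD piN opprB tel.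
  have := nsqD_le (pi k (- (A N - l))) ((pi k (A N) - A N) + (A N - l)).
  have := nsqD_le (pi k (A N) - A N) (A N - l).
  rewrite nsq_pi nsqN; lra.
have l0 := noinv linv; rewrite l0 in AlP.
have at_ge0 := atom_ge0 mu 0.
apply/eqP; rewrite eq_le at_ge0 andbT; apply/ler_addgt0Pr => e e0; rewrite add0r.
apply: (cvgr_to_le (@qform_avgv_cvg _ mu)); near=> N.
have : nsq (A N - 0) < nsq x * e by near: N; apply: AlP; rewrite mulr_gt0.
by rewrite subr0 qE ltr_pM2l// => /ltW.
Unshelve. all: by end_near. Qed.

End UnitaryRep.

(** If no such measure existed for [e], then [Num.sqrt e] would be a Kazhdan constant: a
    displacement below it yields [1 - Ex mu (cosn n) <= e / 2] on [Q]. *)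
Lemma not_Kazhdan_almost1 (R : realType) (Q : set int) : generates_Z Q ->
  ~ Kazhdan_set R Q -> forall e : R, 0 < e -> exists mu : probability R R,
  atom mu 0 = 0 /\ forall n, Q n -> 1 - e <= Ex mu (cosn n).
Proof.
move=> gQ nK e e0; apply: contrapT => nmu; apply: nK.
exists (Num.sqrt e); split; first by rewrite sqrtr_gt0.
move=> V ip pi [Hip complete] Hpi [x [c [cx xQ]]]; apply: contrapT => ninv.
have noinv y : (forall n, pi n y = y) -> y = 0.
  by move=> yP; apply: contrapT => y0; apply: ninv; exists y.
(* Only an element of [Q] is extracted here: it forces [0 <= c], and then the strict inequality
   forces [x] to be nonzero. *)
have [q Qq _] : exists2 n, Q n & cosn n (2^-1 : R) != 1.
  by apply: generates_cosn => //; rewrite lt_eqF// cosn1_lt1//; apply/andP; split; lra.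
have c0 : 0 <= c by rewrite (le_trans _ (xQ q Qq))// sqrtr_ge0.
have x0 : hnorm ip x != 0.
  by apply/eqP => x0; move: cx; rewrite x0 mulr0 ltNge c0.
have [mu [mu0 muP]] := spectral_measure Hip Hpi complete x0 noinv.
apply: nmu; exists mu; split=> // n Qn.
have hx : 0 < hnorm ip x by rewrite lt_neqAle eq_sym x0 sqrtr_ge0.
have : hnorm ip (pi n x - x) ^+ 2 <= e * hnorm ip x ^+ 2.
  rewrite -(@sqr_sqrtr _ e) ?(ltW e0)// -exprMn ler_sqr ?nnegrE ?sqrtr_ge0//; last first.
    by rewrite mulr_ge0 ?sqrtr_ge0.
  exact: le_trans (xQ n Qn) (ltW cx).
rewrite muP mulrAC ler_pM2r ?exprn_gt0//; lra.
Qed.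

(** * The Hilbert space of a positive definite function *)

(** The additive function [D] vanishes on the integers, so it is bounded on all of [R]; since
    [D (k * t) = k * D t], it is 0. *)
Lemma additive_bounded_linear (R : realType) (d : R -> R) (C : R) :
  (forall s t, d (s + t) = d s + d t) -> (forall t, 0 <= t <= 1 -> `|d t| <= C) ->
  forall t, d t = t * d 1.
Proof.
move=> dD dC t; pose D s := d s - s * d 1.
have DD a b : D (a + b) = D a + D b by rewrite /D dD; ring.
have D0 : D 0 = 0 by apply: (addrI (D 0)); rewrite -DD !addr0.
have DN a : D (- a) = - D a by apply: (addrI (D a)); rewrite -DD !subrr.
have Dn a (k : nat) : D (k%:R * a) = k%:R * D a.
  elim: k => [|k IH]; first by rewrite !mul0r.
  by rewrite -natr1 !mulrDl !mul1r DD IH.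
have D1 : D 1 = 0 by rewrite /D mul1r subrr.
have Dz (m : int) : D m%:~R = 0.
  have Dp (k : nat) : D k%:R = 0 by rewrite -[k%:R]mulr1 Dn D1 mulr0.
  by case: (intP m) => [|k|k]; rewrite ?intrN ?DN -pmulrn Dp ?oppr0.
have DC a : `|D a| <= C + `|d 1|.
  rewrite -[a](subrK (Num.floor a)%:~R) DD Dz addr0.
  have a0 : 0 <= a - (Num.floor a)%:~R <= 1.
    by rewrite subr_ge0 ge_floor lerBlDl ltW// -[X in _ + X]/(1%:~R) -intrD floorD1_gt.
  rewrite /D (le_trans (ler_normB _ _))// lerD ?dC// normrM ler_piMl//.
  by case/andP: a0 => ? ?; rewrite ger0_norm.
suff : D t = 0 by move/eqP; rewrite subr_eq0 => /eqP.
apply/eqP; rewrite -normr_le0.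
have cv0 : (C + `|d 1|) * k.+1%:R^-1 @[k --> \oo] --> ((C + `|d 1|) * 0 : R).
  by apply: cvgMr; exact: cvg_harmonic.
rewrite mulr0 in cv0; apply: (cvgr_to_ge cv0); near=> k.
rewrite ler_pdivlMr ?ltr0n// mulrC -[X in X * _](normr_nat R) -normrM -Dn.
exact: DC.
Unshelve. all: by end_near. Qed.

(** * The inner product of a squared norm satisfying the parallelogram law *)

Section JordanVonNeumann.
Context (R : realType) (W : lmodType R) (S : W -> Prop) (N : W -> R).
Context (SD : forall x y, S x -> S y -> S (x + y)) (SZ : forall c x, S x -> S (c *: x)).
Context (N_ge0 : forall x, S x -> 0 <= N x).
Context (NZ : forall c x, S x -> N (c *: x) = c ^+ 2 * N x).
Context (Npar : forall x y, S x -> S y -> N (x + y) + N (x - y) = 2 * N x + 2 * N y).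

Let SN x : S x -> S (- x).
Proof. by move=> Sx; rewrite -scaleN1r; exact: SZ. Qed.

Let SB x y : S x -> S y -> S (x - y).
Proof. by move=> Sx Sy; apply: SD => //; exact: SN. Qed.

Let NN x : S x -> N (- x) = N x.
Proof. by move=> Sx; rewrite -scaleN1r NZ// sqrrN expr1n mul1r. Qed.

Definition polar x y : R := (N (x + y) - N (x - y)) / 4.

Lemma polarC x y : S x -> S y -> polar x y = polar y x.
Proof. by move=> Sx Sy; rewrite /polar [x + y]addrC -[x - y]opprB NN//; exact: SB. Qed.

Lemma polarxx x : S x -> polar x x = N x.
Proof.
move=> Sx; have := Npar Sx Sx; rewrite /polar subrr.
have -> : N 0 = 0 by rewrite -(scale0r x) NZ// expr0n mul0r.
by lra.
Qed.

(** In [H] the parallelogram law is used twice with [x] and [y] exchanged. Its last two terms are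
    swapped when [z] becomes [- z], as [N] is even, and so cancel in the difference. *)
Lemma polarD x y z : S x -> S y -> S z -> polar (x + y) z = polar x z + polar y z.
Proof.
move=> Sx Sy Sz.
have H w : S w -> 2 * N (x + y + w) =
    2 * N (x + w) + 2 * N (y + w) + 2 * N x + 2 * N y - N (x + w - y) - N (y + w - x).
  move=> Sw; have := Npar (SD Sx Sw) Sy; have := Npar (SD Sy Sw) Sx.
  by rewrite [x + w + y]addrAC [y + w + x]addrAC [y + x]addrC; lra.
have := H z Sz; have := H (- z) (SN Sz).
have E a b : a - z - b = - (b + z - a) by rewrite opprB opprD addrA addrAC.
rewrite !E !NN; [|exact: SB (SD Sx Sz) Sy|exact: SB (SD Sy Sz) Sx].
rewrite /polar; lra.
Qed.

Lemma polar_le x y : S x -> S y -> `|polar x y| <= (N x + N y) / 2.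
Proof.
move=> Sx Sy; have := Npar Sx Sy; have := N_ge0 (SD Sx Sy); have := N_ge0 (SB Sx Sy).
by rewrite /polar ler_norml => ? ? ?; apply/andP; split; lra.
Qed.

Lemma polarZ c x y : S x -> S y -> polar (c *: x) y = c * polar x y.
Proof.
move=> Sx Sy.
rewrite (@additive_bounded_linear R (fun t => polar (t *: x) y) ((N x + N y) / 2)).
- by rewrite scale1r.
- by move=> s t; rewrite scalerDl polarD//; exact: SZ.
- move=> t /andP[t0 t1]; rewrite (le_trans (polar_le _ _))//; first exact: SZ.
  rewrite ler_pM2r ?invr_gt0// lerD2r NZ// ler_piMl ?N_ge0//.
  by rewrite expr_le1.
Qed.

End JordanVonNeumann.

(** * The real reproducing kernel Hilbert space of a positive definite function *)

Section RKHS.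
Context (R : realType) (phi : int -> R) (pd : posdef phi) (phi01 : phi 0 = 1).
Implicit Types (f g : int -> R) (v w : seq (R * int)).

Definition kfun w n : R := \sum_(q <- w) q.1 * phi (n - q.2).

Lemma qformE v : qform phi v = evl (kfun v) v.
Proof.
apply: eq_bigr => p _; rewrite /kfun mulr_sumr; apply: eq_bigr => q _.
by rewrite mulrA.
Qed.

Lemma kfun_cat v w n : kfun (v ++ w) n = kfun v n + kfun w n.
Proof. exact: big_cat. Qed.

Lemma kfun_scale a v n : kfun (scalev a v) n = a * kfun v n.
Proof. by rewrite /kfun big_map mulr_sumr; apply: eq_bigr => p _; rewrite mulrA. Qed.

Lemma evl_kfunC v w : evl (kfun v) w = evl (kfun w) v.
Proof.
rewrite /evl /kfun; under eq_bigr do rewrite mulr_sumr.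
rewrite exchange_big /=; apply: eq_bigr => q _; rewrite mulr_sumr.
by apply: eq_bigr => p _; rewrite -opprB pd.1 mulrCA.
Qed.

Lemma qform_cat v w :
  qform phi (v ++ w) = qform phi v + qform phi w + 2 * evl (kfun w) v.
Proof.
have E u : evl (kfun (v ++ w)) u = evl (kfun v) u + evl (kfun w) u.
  by rewrite -evlD; congr evl; apply/funext => n; rewrite kfun_cat.
by rewrite !qformE evl_cat !E (evl_kfunC v w); ring.
Qed.

Lemma qform_scale a v : qform phi (scalev a v) = a ^+ 2 * qform phi v.
Proof.
rewrite !qformE evl_scale (_ : kfun _ = fun n => a * kfun v n); last first.
  by apply/funext => n; rewrite kfun_scale.
by rewrite evlZ; ring.
Qed.

Lemma evl_kfun_scale a w v : evl (kfun (scalev a w)) v = a * evl (kfun w) v.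
Proof. by rewrite -evlZ; congr evl; apply/funext => n; rewrite kfun_scale. Qed.

(** Since [2 a b - b^2 <= a^2], the supremum over [v] is the squared dual norm of [evl f]. There is
    no quotient by [qform phi v], which can vanish, and the parallelogram law reduces to the
    identity [jval_par]. *)
Definition jval f v := 2 * evl f v - qform phi v.
Definition nsqset f : set R := range (jval f).
Definition rk f := has_ubound (nsqset f).
(* The squared norm of f in the reproducing kernel Hilbert space of phi,
   i.e. the squared norm of the functional evl f for the seminorm qform phi *)
Definition rknsq f : R := sup (nsqset f).

Lemma jval_nil f : jval f [::] = 0.
Proof. by rewrite /jval /evl /qform !big_nil mulr0 subrr. Qed.

Lemma jval_le f v : rk f -> jval f v <= rknsq f.
Proof. by move=> rf; apply: ub_le_sup => //; exists v. Qed.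

Lemma rknsq_le f C : (forall v, jval f v <= C) -> rknsq f <= C.
Proof.
move=> fC; apply: ge_sup; first by exists (jval f [::]), [::].
by move=> _ [v _ <-].
Qed.

Lemma rk_le f C : (forall v, jval f v <= C) -> rk f.
Proof. by move=> fC; exists C => _ [v _ <-]. Qed.

Lemma rknsq_ge0 f : rk f -> 0 <= rknsq f.
Proof. by move=> rf; rewrite -(jval_nil f) jval_le. Qed.

Lemma jval_par f g v w : jval (f + g) v + jval (f - g) w =
  2 * jval f (scalev 2^-1 (v ++ w)) + 2 * jval g (scalev 2^-1 (v ++ scalev (-1) w)).
Proof.
have ED u : evl (f + g) u = evl f u + evl g u by rewrite -evlD.
have EB u : evl (f - g) u = evl f u - evl g u.
  rewrite -[- evl g u]mulN1r -evlZ -evlD; congr evl; apply/funext => n.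
  by rewrite mulN1r.
rewrite /jval ED EB !evl_scale !evl_cat !evl_scale.
by rewrite !qform_scale !qform_cat !qform_scale !evl_kfun_scale; field.
Qed.

Lemma rkD_le f g : rk f -> rk g -> forall v w,
  jval (f + g) v + jval (f - g) w <= 2 * rknsq f + 2 * rknsq g.
Proof. by move=> rf rg v w; rewrite jval_par lerD// ler_pM2l// jval_le. Qed.

Lemma rkD f g : rk f -> rk g -> rk (f + g).
Proof.
move=> rf rg; apply: (@rk_le _ (2 * rknsq f + 2 * rknsq g)) => v.
by rewrite -[leLHS]addr0 -(jval_nil (f - g)); exact: rkD_le.
Qed.

Lemma jvalZ c f v : c != 0 -> jval (c *: f) v = c ^+ 2 * jval f (scalev c^-1 v).
Proof.
move=> c0; rewrite /jval (_ : evl (c *: f) v = c * evl f v); last by rewrite -evlZ.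
by rewrite evl_scale qform_scale; field.
Qed.

Lemma rk0 : rk 0 /\ rknsq 0 = 0.
Proof.
have H v : jval 0 v <= 0.
  rewrite /jval (_ : evl 0 v = 0) ?mulr0 ?sub0r ?oppr_le0 ?pd.2//.
  by rewrite /evl big1// => p _; rewrite mulr0.
have r0 := rk_le H; split=> //.
by apply/eqP; rewrite eq_le rknsq_ge0// andbT; exact: rknsq_le.
Qed.

Lemma rkZ c f : rk f -> rk (c *: f).
Proof.
move=> rf; have [->|c0] := eqVneq c 0; first by rewrite scale0r; exact: rk0.1.
apply: (@rk_le _ (c ^+ 2 * rknsq f)) => v.
by rewrite jvalZ// ler_pM2l ?jval_le// exprn_even_gt0.
Qed.

Lemma rknsqZ c f : rk f -> rknsq (c *: f) = c ^+ 2 * rknsq f.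
Proof.
have le a g : a != 0 -> rk g -> rknsq (a *: g) <= a ^+ 2 * rknsq g.
  move=> a0 rg; apply: rknsq_le => v.
  by rewrite jvalZ// ler_pM2l ?jval_le// exprn_even_gt0.
move=> rf; have [->|c0] := eqVneq c 0.
  by rewrite scale0r rk0.2 expr0n mul0r.
apply/eqP; rewrite eq_le le//=.
have := le c^-1 (c *: f) (invr_neq0 c0) (rkZ c rf).
by rewrite scalerA mulVf// scale1r exprVn ler_pdivlMl// exprn_even_gt0.
Qed.

Lemma rkB f g : rk f -> rk g -> rk (f - g).
Proof. by move=> rf rg; rewrite -scaleN1r; apply: rkD => //; exact: rkZ. Qed.

Lemma rknsq_par_le f g : rk f -> rk g ->
  rknsq (f + g) + rknsq (f - g) <= 2 * rknsq f + 2 * rknsq g.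
Proof.
move=> rf rg; rewrite -lerBrDr; apply: rknsq_le => v.
rewrite lerBrDr -lerBrDl; apply: rknsq_le => w; rewrite lerBrDl.
exact: rkD_le.
Qed.

(** The reverse inequality is [rknsq_par_le] for [f + g] and [f - g]. *)
Lemma rknsq_par f g : rk f -> rk g ->
  rknsq (f + g) + rknsq (f - g) = 2 * rknsq f + 2 * rknsq g.
Proof.
move=> rf rg; apply/eqP; rewrite eq_le rknsq_par_le//=.
have := rknsq_par_le (rkD rf rg) (rkB rf rg).
have -> : f + g + (f - g) = 2 *: f.
  by rewrite addrACA subrr addr0 -mulr2n scaler_nat.
have -> : f + g - (f - g) = 2 *: g.
  by rewrite opprB [f + g]addrC addrACA subrr addr0 -mulr2n scaler_nat.
by rewrite !rknsqZ//; lra.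
Qed.

(** Test with weight [f n] at the point [n]. Evaluations are thus continuous, which gives
    definiteness of the norm and pointwise limits of Cauchy sequences. *)
Lemma rk_val f n : rk f -> f n ^+ 2 <= rknsq f.
Proof.
move=> rf; apply: le_trans (jval_le [:: (f n, n)] rf).
rewrite /jval /evl /qform !big_seq1 /= subrr phi01; lra.
Qed.

(** Completing the square: the supremum is attained at [v = w]. *)
Lemma jval_kfun w v : jval (kfun w) v = qform phi w - qform phi (v ++ scalev (-1) w).
Proof. by rewrite /jval qform_cat qform_scale evl_kfun_scale; ring. Qed.

Lemma rk_kfun w : rk (kfun w).
Proof.
by apply: (@rk_le _ (qform phi w)) => v; rewrite jval_kfun gerBl pd.2.
Qed.

Lemma rknsq_kfun w : rknsq (kfun w) = qform phi w.
Proof.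
apply/eqP; rewrite eq_le; apply/andP; split.
  by apply: rknsq_le => v; rewrite jval_kfun gerBl pd.2.
rewrite (le_trans _ (jval_le w (rk_kfun w)))// jval_kfun qform_cat qform_scale.
by rewrite evl_kfun_scale -qformE; lra.
Qed.

Definition shiftf k f n : R := f (n - k).

Lemma qform_shift k v : qform phi (shiftv k v) = qform phi v.
Proof.
rewrite /qform big_map; apply: eq_bigr => p _; rewrite big_map; apply: eq_bigr => q _ /=.
by rewrite opprD addrACA subrr addr0.
Qed.

Lemma jval_shift k f v : jval (shiftf k f) v = jval f (shiftv (- k) v).
Proof. by rewrite /jval qform_shift evl_shift. Qed.

Lemma rk_shift k f : rk f -> rk (shiftf k f).
Proof.
by move=> rf; apply: (@rk_le _ (rknsq f)) => v; rewrite jval_shift jval_le.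
Qed.

Lemma shiftfK k f : shiftf (- k) (shiftf k f) = f.
Proof. by apply/funext => n; rewrite /shiftf opprK addrK. Qed.

Lemma rknsq_shift k f : rk f -> rknsq (shiftf k f) = rknsq f.
Proof.
have le j g : rk g -> rknsq (shiftf j g) <= rknsq g.
  by move=> rg; apply: rknsq_le => v; rewrite jval_shift jval_le.
move=> rf; apply/eqP; rewrite eq_le le//=.
by have := le (- k) _ (rk_shift k rf); rewrite shiftfK.
Qed.

(** Cauchy sequences converge pointwise; for fixed [v], [jval] depends on finitely many values, so
    its bounds pass to the limit and then to the supremum. *)
Lemma rk_complete (u : nat -> int -> R) : (forall m, rk (u m)) ->
  (forall e, 0 < e -> exists K, forall m n, (K <= m)%N -> (K <= n)%N ->
    rknsq (u m - u n) <= e) ->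
  exists2 l, rk l & forall e, 0 < e -> exists K, forall n, (K <= n)%N ->
    rknsq (u n - l) <= e.
Proof.
move=> ru cu.
have cvu i : cvgn (fun m => u m i).
  apply: cauchy_cvg; apply: cauchy_exP => e' e0'.
  have [e eE e0] : exists2 e : R, e' = e & 0 < e by exists e'.
  rewrite {e' e0'}eE.
  have e2 : 0 < (e / 2) ^+ 2 by rewrite exprn_gt0//; lra.
  have [K KP] := cu _ e2; exists (u K i); exists K => // n /= Kn.
  rewrite /ball /=; have := rk_val i (rkB (ru K) (ru n)).
  move=> /le_trans /(_ (KP _ _ (leqnn K) Kn)).
  rewrite -real_normK ?num_real// ler_sqr ?nnegrE//; last by lra.
  move=> h; rewrite (le_lt_trans h)//; lra.
pose l i := limn (fun m => u m i).
have lP e K m : (forall n, (K <= n)%N -> rknsq (u m - u n) <= e) ->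
    forall v, jval (u m - l) v <= e.
  move=> Ke v.
  have cv : jval (u m - u n) v @[n --> \oo] --> jval (u m - l) v.
    apply: cvgB; last exact: cvg_cst.
    apply: cvgMr; apply: cvg_sumr => p; apply: cvgMr.
    by apply: cvgB; [exact: cvg_cst|exact: cvu].
  apply: (cvgr_to_le cv); near=> n; rewrite (le_trans _ (Ke n _))//.
    by apply: jval_le; exact: rkB.
  by near: n; exact: nbhs_infty_ge.
have rl : rk l.
  have [K KP] := cu 1 ltr01.
  have rul : rk (u K - l).
    by apply: rk_le; apply: (lP 1 K K) => n Kn; exact: KP.
  have -> : l = u K - (u K - l) by rewrite opprB addrC subrK.
  exact: rkB.
exists l => // e e0; have [K KP] := cu e e0; exists K => n Kn.
by apply: rknsq_le; apply: (lP e K n) => m Km; exact: KP.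
Unshelve. all: by end_near. Qed.

End RKHS.

(** * Its complexification and the translation representation *)

Section ComplexRKHS.
Context (R : realType) (phi : int -> R) (pd : posdef phi) (phi01 : phi 0 = 1).
Implicit Types (F G H : int -> R[i]).

Definition ref F n : R := complex.Re (F n).
Definition imf F n : R := complex.Im (F n).

Definition crk_pred : {pred int -> R[i]} := fun F => `[< rk phi (ref F) /\ rk phi (imf F) >].

Let refD F G : ref (F + G) = ref F + ref G.
Proof. by apply/funext => n; rewrite /ref /= !fctE; case: (F n) (G n) => [? ?] []. Qed.

Let imfD F G : imf (F + G) = imf F + imf G.
Proof. by apply/funext => n; rewrite /imf /= !fctE; case: (F n) (G n) => [? ?] []. Qed.

Let refZ a F : ref (a *: F) = complex.Re a *: ref F - complex.Im a *: imf F.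
Proof.
by apply/funext => n; rewrite /ref /imf /= !fctE; case: a (F n) => [? ?] [].
Qed.

Let imfZ a F : imf (a *: F) = complex.Re a *: imf F + complex.Im a *: ref F.
Proof.
by apply/funext => n; rewrite /ref /imf /= !fctE; case: a (F n) => [? ?] [].
Qed.

Lemma crk_submod_closed : submod_closed crk_pred.
Proof.
split.
  apply/asboolP; split.
    by rewrite (_ : ref 0 = 0); [exact: (rk0 pd).1|apply/funext].
  by rewrite (_ : imf 0 = 0); [exact: (rk0 pd).1|apply/funext].
move=> a F G /asboolP[rF iF] /asboolP[rG iG]; apply/asboolP.
rewrite refD imfD refZ imfZ; split; apply: rkD => //.
  by apply: rkB => //; exact: rkZ.
by apply: rkD => //; exact: rkZ.
Qed.

HB.instance Definition _ := GRing.isSubmodClosed.Build _ _ crk_pred crk_submod_closed.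

Record crk := Crk { crk_val :> int -> R[i] ; _ : crk_val \in crk_pred }.

HB.instance Definition _ := [isSub for crk_val].
HB.instance Definition _ := [Choice of crk by <:].
HB.instance Definition _ := [SubChoice_isSubLmodule of crk by <:].

Implicit Types (u w z : crk).

Let N := rknsq phi.
Let B := polar N.

Let re_rk u : rk phi (ref u).
Proof. by case: u => F /= /asboolP[]. Qed.

Let im_rk u : rk phi (imf u).
Proof. by case: u => F /= /asboolP[]. Qed.

Let BC f g : rk phi f -> rk phi g -> B f g = B g f.
Proof. by apply: polarC; [exact: rkD|exact: rkZ|exact: rknsqZ]. Qed.

Let Bxx f : rk phi f -> B f f = N f.
Proof. by apply: polarxx; [exact: rknsqZ|exact: rknsq_par]. Qed.

Let BD f g h : rk phi f -> rk phi g -> rk phi h -> B (f + g) h = B f h + B g h.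
Proof.
by apply: (@polarD _ _ (rk phi)); [exact: rkD|exact: rkZ|exact: rknsqZ|exact: rknsq_par].
Qed.

Let BZ c f g : rk phi f -> rk phi g -> B (c *: f) g = c * B f g.
Proof.
by apply: polarZ; [exact: rkD|exact: rkZ|exact: rknsq_ge0|exact: rknsqZ|exact: rknsq_par].
Qed.

Definition cip u w : R[i] :=
  ((B (ref u) (ref w) + B (imf u) (imf w)) +i* (B (imf u) (ref w) - B (ref u) (imf w)))%C.

Lemma cip_inner_product : is_inner_product cip.
Proof.
split.
- move=> a u w z.
  have re_lin : ref (a *: u + w) = complex.Re a *: ref u - complex.Im a *: imf u + ref w.
    by rewrite -refZ -refD.
  have im_lin : imf (a *: u + w) = complex.Re a *: imf u + complex.Im a *: ref u + imf w.
    by rewrite -imfZ -imfD.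
  have Bl f g h (c d : R) : rk phi f -> rk phi g -> rk phi h -> forall k, rk phi k ->
      B (c *: f + d *: g + h) k = c * B f k + d * B g k + B h k.
    move=> rf rg rh k rkk; rewrite !BD ?BZ//; try exact: rkZ.
    by apply: rkD => //; exact: rkZ.
  have BlB f g h (c d : R) : rk phi f -> rk phi g -> rk phi h -> forall k, rk phi k ->
      B (c *: f - d *: g + h) k = c * B f k - d * B g k + B h k.
    by move=> rf rg rh k rkk; rewrite -scaleNr Bl// mulNr.
  apply/eqP; rewrite eq_complex /cip re_lin im_lin !Bl// !BlB//.
  by case: a {re_lin im_lin} => a b /=; apply/andP; split; apply/eqP; ring.
- move=> u w; apply/eqP; rewrite eq_complex /=; apply/andP; split; apply/eqP.
    by rewrite (BC (re_rk w) (re_rk u)) (BC (im_rk w) (im_rk u)).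
  by rewrite (BC (im_rk w) (re_rk u)) (BC (re_rk w) (im_rk u)) opprB.
- move=> u /=; rewrite (BC (im_rk u) (re_rk u)) subrr !Bxx//; split=> //.
  by rewrite addr_ge0// rknsq_ge0.
- move=> u /eqP; rewrite eq_complex /= !Bxx// => /andP[/eqP n0 _].
  have [re0 im0] : N (ref u) = 0 /\ N (imf u) = 0.
    by have := rknsq_ge0 (re_rk u); have := rknsq_ge0 (im_rk u); rewrite -/N; lra.
  have z0 f : rk phi f -> N f = 0 -> forall n, f n = 0.
    move=> rf f0 n; apply/eqP; rewrite -sqrf_eq0 eq_le sqr_ge0 andbT -f0.
    exact: rk_val.
  apply: val_inj; apply/funext => n; apply/eqP; rewrite eq_complex.
  by rewrite -/(ref u n) -/(imf u n) !z0//= eqxx.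
Qed.

Let hnormE u : hnorm cip u = Num.sqrt (N (ref u) + N (imf u)).
Proof. by rewrite /hnorm /= !Bxx. Qed.

Let hnorm_sqr u : hnorm cip u ^+ 2 = N (ref u) + N (imf u).
Proof. by rewrite hnormE sqr_sqrtr// addr_ge0// rknsq_ge0. Qed.

Let refB u w : ref (u - w) = ref u - ref w.
Proof. by apply/funext => n; rewrite /ref /= !fctE; case: (crk_val u n) (crk_val w n) => [? ?] []. Qed.

Let imfB u w : imf (u - w) = imf u - imf w.
Proof. by apply/funext => n; rewrite /imf /= !fctE; case: (crk_val u n) (crk_val w n) => [? ?] []. Qed.

Lemma cip_complete : is_complete cip.
Proof.
move=> u cu.
have cu2 e : 0 < e -> exists K, forall m n, (K <= m)%N -> (K <= n)%N ->
    N (ref (u m) - ref (u n)) <= e /\ N (imf (u m) - imf (u n)) <= e.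
  move=> e0; have [K KP] : exists K : nat, forall m n : nat,
      (K <= m)%N -> (K <= n)%N -> hnorm cip (u m - u n) < Num.sqrt e.
    by apply: cu; rewrite sqrtr_gt0.
  exists K => m n Km Kn; have := KP m n Km Kn.
  rewrite -ltr_sqr ?nnegrE ?sqrtr_ge0// hnorm_sqr sqr_sqrtr ?(ltW e0)//.
  have := rknsq_ge0 (re_rk (u m - u n)); have := rknsq_ge0 (im_rk (u m - u n)).
  by rewrite -/N refB imfB => ? ? ?; split; lra.
have [|l1 rl1 l1P] := rk_complete pd phi01 (fun m => re_rk (u m)).
  move=> e e0; have [K KP] := cu2 e e0; exists K => m n Km Kn.
  by have [] := KP m n Km Kn.
have [|l2 rl2 l2P] := rk_complete pd phi01 (fun m => im_rk (u m)).
  move=> e e0; have [K KP] := cu2 e e0; exists K => m n Km Kn.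
  by have [] := KP m n Km Kn.
pose F n : R[i] := (l1 n +i* l2 n)%C.
have FP : F \in crk_pred by apply/asboolP; split.
exists (Crk FP) => e e0.
have e3 : 0 < e ^+ 2 / 3 by rewrite divr_gt0// exprn_gt0.
have [K1 K1P] := l1P _ e3; have [K2 K2P] := l2P _ e3.
exists (maxn K1 K2) => n; rewrite geq_max => /andP[Kn1 Kn2].
rewrite -ltr_sqr ?nnegrE ?sqrtr_ge0 ?(ltW e0)// hnorm_sqr refB imfB.
have := K1P n Kn1; have := K2P n Kn2.
have -> : ref (Crk FP) = l1 by [].
have -> : imf (Crk FP) = l2 by [].
have := exprn_gt0 2 e0.
by rewrite -/N; lra.
Qed.

Lemma crk_shift k u : (fun n => u (n - k)) \in crk_pred.
Proof. by apply/asboolP; split; [exact: rk_shift (re_rk u)|exact: rk_shift (im_rk u)]. Qed.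

Definition cshift k u : crk := Crk (crk_shift k u).

Let BS k f g : rk phi f -> rk phi g -> B (shiftf k f) (shiftf k g) = B f g.
Proof.
move=> rf rg; rewrite /B /polar -[shiftf k f + _]/(shiftf k (f + g)).
rewrite -[shiftf k f - _]/(shiftf k (f - g)) /N !rknsq_shift//; first exact: rkB.
exact: rkD.
Qed.

Lemma cshift_unitary : unitary_rep cip cshift.
Proof.
split.
- by move=> u; apply: val_inj; apply/funext => n /=; rewrite subr0.
- move=> m k u; apply: val_inj; apply/funext => n /=.
  by rewrite opprD addrA.
- by move=> k a u w; apply: val_inj; apply/funext => n.
- move=> k u w; rewrite /cip.
  have re z : ref (cshift k z) = shiftf k (ref z) by [].
  have im z : imf (cshift k z) = shiftf k (imf z) by [].
  by rewrite !re !im !BS.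
Qed.

Let phi_rk : rk phi phi /\ N phi = 1.
Proof.
have E : kfun phi [:: (1, 0)] = phi.
  by apply/funext => n; rewrite /kfun big_seq1 /= mul1r subr0.
have rE := rk_kfun pd [:: (1, 0)]; have nE := rknsq_kfun pd [:: (1, 0)].
rewrite E in rE nE; split=> //.
by rewrite /N nE /qform !big_seq1 /= subrr phi01 !mulr1.
Qed.

Let delta0_subproof : (fun n => (phi n)%:C%C) \in crk_pred.
Proof.
apply/asboolP; split; first exact: phi_rk.1.
by rewrite (_ : imf _ = 0); [exact: (rk0 pd).1|apply/funext].
Qed.

Let delta0 : crk := Crk delta0_subproof.

Let hnorm_delta0 : hnorm cip delta0 = 1.
Proof.
rewrite hnormE (_ : ref _ = phi) ?phi_rk.2// (_ : imf _ = 0); last by apply/funext.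
by rewrite /N (rk0 pd).2 addr0 sqrtr1.
Qed.

Let hnorm_shift_delta0 k : hnorm cip (cshift k delta0 - delta0) = Num.sqrt (2 - 2 * phi k).
Proof.
rewrite hnormE refB imfB; congr Num.sqrt.
have -> : ref (cshift k delta0) - ref delta0 = kfun phi [:: (1, k); (-1, 0)].
  apply/funext => n; rewrite /kfun big_cons big_seq1 /= mul1r mulN1r subr0.
  by [].
have -> : imf (cshift k delta0) - imf delta0 = 0.
  by apply/funext => n; rewrite !fctE /imf /= subrr.
rewrite /N rknsq_kfun// (rk0 pd).2 addr0 /qform !big_cons !big_nil /=.
by rewrite !subrr subr0 sub0r pd.1 phi01; ring.
Qed.

(** Against [r] times a long average, a constant [a] gives [2 * (r * a)] while the quadratic term
    tends to 0; a finite norm bounds this for all [r]. *)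
Let const_rk0 (a : R) : qform phi (avgv R n) @[n --> \oo] --> (0 : R) ->
  rk phi (fun=> a) -> a = 0.
Proof.
move=> q0 ra; apply/eqP/negPn/negP => a0.
have rgt (r : R) : 2 * (r * a) <= N (fun=> a).
  have cv : 2 * (r * a) - r ^+ 2 * qform phi (avgv R n) @[n --> \oo] -->
      2 * (r * a) - r ^+ 2 * 0.
    by apply: cvgB; [exact: cvg_cst|apply: cvgMr].
  rewrite mulr0 subr0 in cv; apply: (cvgr_to_le cv); near=> n.
  have := jval_le (scalev r (avgv R n)) ra; rewrite /jval qform_scale// evl_scale evl_avgv.
  rewrite (_ : avg n _ = a)// /avg sumr_const card_ord -[a *+ n]mulr_natl mulrA mulVf ?mul1r//.
  by rewrite pnatr_eq0 -lt0n; near: n; exact: nbhs_infty_gt.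
have := rgt ((N (fun=> a) + 1) / a); rewrite divfK//.
have := rknsq_ge0 ra; rewrite -/N; lra.
Unshelve. all: by end_near. Qed.

Lemma crk_no_invariant : qform phi (avgv R n) @[n --> \oo] --> (0 : R) ->
  forall u, (forall n, cshift n u = u) -> u = 0.
Proof.
move=> q0 u inv; have uc n : u n = u 0.
  by have := congr1 (fun w : crk => w 0) (inv (- n)) => /=; rewrite sub0r opprK.
have r0 : complex.Re (u 0) = 0.
  apply: const_rk0 => //; rewrite (_ : (fun=> _) = ref u)//.
  by apply/funext => n; rewrite /ref uc.
have i0 : complex.Im (u 0) = 0.
  apply: const_rk0 => //; rewrite (_ : (fun=> _) = imf u)//.
  by apply/funext => n; rewrite /imf uc.
apply: val_inj; apply/funext => n; rewrite /= uc.
by apply/eqP; rewrite eq_complex r0 i0 /= eqxx.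
Qed.

Lemma Kazhdan_constant_le (eps : R) (Q : set int) : 0 < eps ->
  (forall (V : lmodType R[i]) (ip : V -> V -> R[i]) (pi : int -> V -> V),
      is_Hilbert ip -> unitary_rep ip pi ->
      (exists x : V, exists c : R, c < eps * hnorm ip x /\
          forall n : int, Q n -> hnorm ip (pi n x - x) <= c) ->
      exists y : V, y <> 0 /\ forall n : int, pi n y = y) ->
  qform phi (avgv R n) @[n --> \oo] --> (0 : R) ->
  ~ forall n, Q n -> 1 - eps ^+ 2 / 4 <= phi n.
Proof.
move=> e0 K q0 phiQ.
have [|y [y0 yinv]] := K crk cip cshift (conj cip_inner_product cip_complete) cshift_unitary.
  (* The squared displacement [2 - 2 * phi n] is at most [eps ^+ 2 / 2] on [Q], strictly below
     [eps ^+ 2]. *)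
  exists delta0, (Num.sqrt (eps ^+ 2 / 2)); split.
    rewrite hnorm_delta0 mulr1 -ltr_sqr ?nnegrE ?sqrtr_ge0 ?(ltW e0)//.
    by have := exprn_gt0 2 e0 => ?; rewrite sqr_sqrtr; lra.
  by move=> n Qn; rewrite hnorm_shift_delta0 ler_wsqrtr//; have := phiQ n Qn; lra.
by apply: y0; exact: crk_no_invariant.
Qed.

End ComplexRKHS.

(** * The squared Fourier coefficients of a continuous measure *)

Section SquaredCoefficients.
Context (R : realType) (s : probability R R).

(** [|hat s(n)|^2], the coefficient of [s] convolved with its reflection. The convolution appears
    only as an iterated integral of [cosn n (u - t)], whose variables separate, so Fubini's theorem
    does not intervene. *)
Definition coef2 n : R := Ex s (cosn n) ^+ 2 + Ex s (sinn n) ^+ 2.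

Let inner n t : Ex s (fun u => cosn n (u - t)) =
  cosn n t * Ex s (cosn n) + sinn n t * Ex s (sinn n).
Proof.
have [bc bs] := (@bmeas_cosn R n, @bmeas_sinn R n).
rewrite -!ExZ// -ExD; [|exact: bmeasZ|exact: bmeasZ].
by apply: eq_Ex => u; rewrite cosnBr; ring.
Qed.

Let bmeas_inner n : bmeas (fun t : R => Ex s (fun u => cosn n (u - t))).
Proof.
under eq_fun do rewrite inner.
by apply: bmeasD; apply: bmeasM; first [exact: bmeas_cosn|exact: bmeas_sinn|exact: bmeas_cst].
Qed.

Let coef2E n : coef2 n = Ex s (fun t => Ex s (fun u => cosn n (u - t))).
Proof.
have [bc bs] := (@bmeas_cosn R n, @bmeas_sinn R n).
under eq_Ex do rewrite inner mulrC [X in _ + X]mulrC.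
by rewrite ExD; [|exact: bmeasZ|exact: bmeasZ]; rewrite !ExZ.
Qed.

Lemma posdef_coef2 : posdef coef2.
Proof.
split=> [n|v].
  rewrite /coef2; congr (_ ^+ 2 + _).
    by apply: eq_Ex => t; rewrite cosnN.
  rewrite -sqrrN; congr (_ ^+ 2); rewrite -mulN1r -ExZ; last exact: bmeas_sinn.
  by apply: eq_Ex => t; rewrite sinnN mulN1r opprK.
have -> : qform coef2 v =
    Ex s (fun t => Ex s (fun u => qform (cosn ^~ (u - t)) v)).
  have E t : Ex s (fun u => qform (cosn ^~ (u - t)) v) =
      qform (fun n => Ex s (fun u => cosn n (u - t))) v.
    have bm (a : R) n : bmeas (fun u : R => a * cosn n (u - t)).
      by apply: bmeasZ; exact: bmeas_cosnB.
    rewrite Ex_sum; last by move=> p; apply: bmeas_sum => q; exact: bm.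
    apply: eq_bigr => p _; rewrite Ex_sum => [|q]; last exact: bm.
    by apply: eq_bigr => q _; rewrite ExZ//; exact: bmeas_cosnB.
  have bm (a : R) n : bmeas (fun t : R => a * Ex s (fun u => cosn n (u - t))).
    by apply: bmeasZ.
  under eq_Ex do rewrite E.
  rewrite Ex_sum; last by move=> p; apply: bmeas_sum => q; exact: bm.
  apply: eq_bigr => p _; rewrite Ex_sum => [|q]; last exact: bm.
  by apply: eq_bigr => q _; rewrite ExZ// coef2E.
by apply: Ex_ge0 => t; apply: Ex_ge0 => u; rewrite qform_cosn addr_ge0 ?sqr_ge0.
Qed.

Lemma coef2_0 : coef2 0 = 1.
Proof.
rewrite /coef2 (@eq_Ex _ _ _ _ _ (fun=> 1)) ?Ex_cst; last exact: cosn0.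
rewrite (@eq_Ex _ _ _ _ _ (fun=> 0)) ?Ex_cst ?expr1n ?expr0n ?addr0//.
by move=> t; apply: cosn1_sinn; exact: cosn0.
Qed.

Context (circ : circle_measure s) (cont : continuous_measure s).

(** The class of [t] meets [[0, 1)] in at most one point, which is null by continuity, and the
    complement of [[0, 1)] is null. *)
Let atom0 t : atom s t = 0.
Proof.
rewrite /atom Ex_indic; last exact: measurable_cos1set.
have m01 : measurable (`[0, 1[ : set R) by exact: measurable_itv.
have out0 : s (~` `[0, 1[) = 0%E.
  have := probability_setC s m01; rewrite [X in (_ - X)%E](_ : _ = 1%E)//.
  by rewrite subee.
suff [p sub] : exists p, cos1set t `<=` [set p] `|` ~` `[0, 1[.
  have /eqP -> : s (cos1set t) == 0%E; last by [].
  rewrite eq_le measure_ge0 andbT.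
  apply: (le_trans (le_measure _ _ _ sub)); rewrite ?inE.
  - exact: measurable_cos1set.
  - by apply: measurableU => //; exact: measurableC.
  apply: (le_trans (measureU2 _ _ _)) => //; first exact: measurableC.
  rewrite [X in (X + _)%E](_ : _ = 0%E); last exact: cont.
  by rewrite [X in (_ + X)%E](_ : _ = 0%E) ?adde0//; exact: out0.
case: (pselect (exists2 p, 0 <= p < 1 & cos1set t p)) => [[p p01 pt]|np].
  exists p => u ut; case: (pselect (0 <= u < 1)) => u01; [left|right].
    apply: cosn1_inj => //; have -> : u - p = u - t - (p - t) by rewrite opprB addrA subrK.
    by rewrite cosnBr ut pt (cosn1_sinn ut) mul0r addr0 mulr1.
  by rewrite /= in_itv.
exists 0 => u ut; right; rewrite /= in_itv /= => u01; apply: np; by exists u.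
Qed.

(* Wiener's lemma: the mean of |hat s|^2 vanishes for a continuous measure *)
Lemma avg_coef2_cvg : avg N coef2 @[N --> \oo] --> (0 : R).
Proof.
have -> : (fun N => avg N coef2) =
    (fun N => Ex s (fun t => avg N (fun n => Ex s (fun u => cosn n (u - t))))).
  apply/funext => N; rewrite (Ex_avg _ _ bmeas_inner).
  by apply: eq_avg => n; exact: coef2E.
rewrite -(Ex_cst s 0).
apply: (@Ex_cvg _ _ _ s (fun N t => avg N (fun n => Ex s (fun u => cosn n (u - t)))) _ 1).
- by move=> N; exact: bmeas_avg.
- move=> N t; apply: avg_norm_le => // n.
  by apply: Ex_norm_le => [|u]; [exact: bmeas_cosnB|exact: normr_cosn].
- by move=> t; rewrite -(atom0 t); exact: avg_Ex_cvg.
Qed.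

(** The simple mean and the double mean of [coef2] both converge to the atom at 0 of its Herglotz
    measure, so the vanishing of the first gives that of the second. *)
Lemma qform_coef2_cvg : qform coef2 (avgv R N) @[N --> \oo] --> (0 : R).
Proof.
have [mu [_ muE]] := herglotz posdef_coef2 coef2_0.
have cv : avg N coef2 @[N --> \oo] --> atom mu 0.
  have -> : coef2 = (fun n => Ex mu (fun t => cosn n (t - 0))); last exact: avg_Ex_cvg.
  by apply/funext => n; rewrite -muE; apply: eq_Ex => t; rewrite subr0.
rewrite -(cvg_unique _ cv avg_coef2_cvg)//.
have -> : coef2 = (fun n => Ex mu (cosn n)) by apply/funext => n; rewrite muE.
exact: qform_avgv_cvg.
Qed.

End SquaredCoefficients.

Theorem mainTheorem8 (R : realType) (Q : set int) :
  generates_Z Q ->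
  (Kazhdan_set R Q <->
   exists delta : R, 0 < delta < 1 /\ ~ delta_Ka_plus delta Q).
Proof.
move=> gQ; split=> [[eps [eps0 K]]|[delta [/andP[_ d1] nKa]]]; last first.
  apply: contrapT => nK; apply: nKa.
  exact: (almost1_delta_Ka_plus gQ (not_Kazhdan_almost1 gQ nK) d1).
(* The first bound keeps [1 - eta] in [(0, 1)]; the second gives [(1 - eta)^2 >= 1 - 2 * eta >= 1 -
   eps ^+ 2 / 4], as squared coefficients are compared. *)
pose eta := Num.min (2^-1) (eps ^+ 2 / 8).
have eta_gt0 : 0 < eta by rewrite lt_min invr_gt0 ltr0n divr_gt0// exprn_gt0.
have eta_le1 : eta <= 2^-1 by rewrite ge_min lexx.
have eta_le2 : eta <= eps ^+ 2 / 8 by rewrite ge_min lexx orbT.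
exists (1 - eta); split; first by apply/andP; split; lra.
move=> [s [circ [cont [c [dc cQ]]]]].
apply: (Kazhdan_constant_le (posdef_coef2 s) (coef2_0 s) eps0 K (qform_coef2_cvg circ cont)).
move=> n /cQ cn.
have coefE : modC (fourier_coef s n) ^+ 2 = coef2 s n.
  by rewrite sqr_sqrtr ?addr_ge0 ?sqr_ge0.
rewrite -coefE; apply: (@le_trans _ _ (c ^+ 2)); first nra.
rewrite ler_sqr ?nnegrE ?sqrtr_ge0//; lra.
Qed.
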